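(* If $A$ is a cluster-tilted algebra of type $\mathbb{D}$, then $A$ has finite Frobenius dimension.
   Context: $\mathsf{k}$ is an algebraically closed field. For a $\mathsf{k}$-algebra $A$ with multiplication $m\colon A\otimes A\to A$, an open Frobenius coproduct is a $\mathsf{k}$-linear map $\Delta\colon A\to A\otimes A$ which is a morphism of $A$-bimodules, i.e. $(m\otimes 1)(1\otimes\Delta)=\Delta\circ m=(1\otimes m)(\Delta\otimes 1)$. These maps form a $\mathsf{k}$-vector space; its dimension is the Frobenius dimension $\operatorname{Frobdim}(A)$. Cluster-tilted algebras: let $H=\mathsf{k}Q$ be the path algebra of a quiver $Q$ whose underlying graph is a Dynkin diagram, $\mathcal{D}=\mathcal{D}^b(H)$ the bounded derived category of finitely generated $H$-modules, $[1]$ its shift functor and $\tau$ its Auslander–Reiten translation. The cluster category is the orbit category $\mathcal{C}=\mathcal{D}/F$ with $F=\tau^{-1}[1]$. An object $T$ of $\mathcal{C}$ is a tilting object if $\operatorname{Ext}^1_{\mathcal{C}}(T,T)=0$ and $T$ is maximal with respect to this property. The algebra $\operatorname{End}_{\mathcal{C}}(T)$ is called a cluster-tilted algebra; it is of type $\mathbb{D}$ if the underlying graph of $Q$ is a Dynkin diagram of type $\mathbb{D}$. *)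

(* Defs.v *)
From HB Require Import structures.
From mathcomp Require Import all_boot all_order all_algebra finmap.
From mathcomp Require Import generic_quotient zify.
From mathcomp Require Import boolp classical_sets functions cardinality.
From mathcomp Require Import fsbigop.

Set Implicit Arguments.
Unset Strict Implicit.
Unset Printing Implicit Defensive.

Import GRing.Theory.
Local Open Scope ring_scope.
Local Open Scope quotient_scope.

(* [U (x) V]: formal sums of pairs [(u, v)], two of them being identified when
   no bilinear map tells them apart. *)
Section Tensor.
Variables (k : fieldType) (U V : lmodType k).

Definition pairing_sum (W : lmodType k) (b : U -> V -> W) (s : seq (U * V)) : W :=
  \sum_(p <- s) b p.1 p.2.

Definition tensor_equiv (s t : seq (U * V)) : bool :=
  `[< forall (W : lmodType k) (b : {bilinear U -> V -> W}),
        pairing_sum b s = pairing_sum b t >].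

Lemma tensor_equiv_refl : reflexive tensor_equiv.
Proof. by move=> s; apply/asboolP. Qed.

Lemma tensor_equiv_sym : symmetric tensor_equiv.
Proof. by move=> s t; apply/asboolP/asboolP => h W b; rewrite h. Qed.

Lemma tensor_equiv_trans : transitive tensor_equiv.
Proof.
move=> t s r /asboolP h1 /asboolP h2; apply/asboolP => W b.
by rewrite h1 h2.
Qed.

Canonical tensor_equiv_rel :=
  EquivRel tensor_equiv tensor_equiv_refl tensor_equiv_sym tensor_equiv_trans.

Definition tensor := {eq_quot tensor_equiv}.
HB.instance Definition _ := Choice.on tensor.
HB.instance Definition _ := EqQuotient.on tensor.

Definition tensor_eval (W : lmodType k) (b : U -> V -> W) (x : tensor) : W :=
  pairing_sum b (repr x).

Lemma tensor_evalE (W : lmodType k) (b : {bilinear U -> V -> W}) s :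
  tensor_eval b (\pi_tensor s) = pairing_sum b s.
Proof.
rewrite /tensor_eval.
have /asboolP -> // : tensor_equiv (repr (\pi_tensor s)) s.
by apply/(@eqquotP _ tensor_equiv_rel); exact: (@reprK _ tensor).
Qed.

Lemma tensor_eq (x y : tensor) :
  (forall (W : lmodType k) (b : {bilinear U -> V -> W}),
     tensor_eval b x = tensor_eval b y) -> x = y.
Proof.
move=> h; rewrite -[x]reprK -[y]reprK.
by apply/(@eqquotP _ tensor_equiv_rel)/asboolP => W b; apply: h.
Qed.

Definition tadd (x y : tensor) : tensor := \pi_tensor (repr x ++ repr y).
Definition tscale (c : k) (x : tensor) : tensor :=
  \pi_tensor [seq (c *: p.1, p.2) | p <- repr x].
Definition tzero : tensor := \pi_tensor [::].

Lemma tensor_eval_add (W : lmodType k) (b : {bilinear U -> V -> W}) x y :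
  tensor_eval b (tadd x y) = tensor_eval b x + tensor_eval b y.
Proof. by rewrite tensor_evalE /pairing_sum big_cat. Qed.

Lemma tensor_eval_scale (W : lmodType k) (b : {bilinear U -> V -> W}) c x :
  tensor_eval b (tscale c x) = c *: tensor_eval b x.
Proof.
rewrite tensor_evalE /pairing_sum big_map scaler_sumr /=.
by apply: eq_bigr => p _; rewrite linearZl_LR.
Qed.

Lemma tensor_eval_zero (W : lmodType k) (b : {bilinear U -> V -> W}) : tensor_eval b tzero = 0.
Proof. by rewrite tensor_evalE /pairing_sum big_nil. Qed.

Definition tensor_evalD := (tensor_eval_add, tensor_eval_scale, tensor_eval_zero).

Fact taddA : associative tadd.
Proof. by move=> x y z; apply: tensor_eq => W b; rewrite !tensor_evalD addrA. Qed.
Fact taddC : commutative tadd.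
Proof. by move=> x y; apply: tensor_eq => W b; rewrite !tensor_evalD addrC. Qed.
Fact tadd0 : left_id tzero tadd.
Proof. by move=> x; apply: tensor_eq => W b; rewrite !tensor_evalD add0r. Qed.
Fact taddN : left_inverse tzero (tscale (-1)) tadd.
Proof.
by move=> x; apply: tensor_eq => W b; rewrite !tensor_evalD scaleN1r addNr.
Qed.
HB.instance Definition _ := GRing.isZmodule.Build tensor taddA taddC tadd0 taddN.

Fact tscaleA a b x : tscale a (tscale b x) = tscale (a * b) x.
Proof. by apply: tensor_eq => W f; rewrite !tensor_evalD scalerA. Qed.
Fact tscale1 : left_id 1 tscale.
Proof. by move=> x; apply: tensor_eq => W b; rewrite !tensor_evalD scale1r. Qed.
Fact tscaleDr : right_distributive tscale +%R.
Proof.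
by move=> a x y; apply: tensor_eq => W b; rewrite !tensor_evalD scalerDr.
Qed.
Fact tscaleDl x : {morph tscale^~ x : a b / a + b}.
Proof.
by move=> a b; apply: tensor_eq => W f; rewrite !tensor_evalD scalerDl.
Qed.
HB.instance Definition _ :=
  GRing.Zmodule_isLmodule.Build k tensor tscaleA tscale1 tscaleDr tscaleDl.

Definition pure (u : U) (v : V) : tensor := \pi_tensor [:: (u, v)].

Lemma tensor_eval_pure (W : lmodType k) (b : {bilinear U -> V -> W}) u v :
  tensor_eval b (pure u v) = b u v.
Proof. by rewrite tensor_evalE /pairing_sum big_seq1. Qed.

Lemma pure_bilinear : bilinear_for *:%R *:%R pure.
Proof.
split=> [v a u u'|u a v v']; apply: tensor_eq => W b;
  by rewrite tensor_eval_add tensor_eval_scale !tensor_eval_pure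
       ?linearPl ?linearPr.
Qed.
HB.instance Definition _ :=
  bilinear_isBilinear.Build k U V tensor *:%R *:%R pure pure_bilinear.

Lemma tensor_eval_linear (W : lmodType k) (b : {bilinear U -> V -> W}) : linear (tensor_eval b).
Proof. by move=> a x y; rewrite tensor_eval_add tensor_eval_scale. Qed.

End Tensor.

Section Frobenius.
Variables (k : fieldType) (A : algType k).

(* The outer bimodule structure of [A (x) A]: [a . (x (x) y) . b = ax (x) yb]. *)
Definition lact (a : A) (t : tensor A A) : tensor A A :=
  tensor_eval (fun x y => pure (a * x) y) t.
Definition ract (t : tensor A A) (a : A) : tensor A A :=
  tensor_eval (fun x y => pure x (y * a)) t.

Lemma lact_pure a x y : lact a (pure x y) = pure (a * x) y.
Proof.
pose f x y : tensor A A := pure (a * x) y.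
have f_bilinear : bilinear_for *:%R *:%R f.
  split=> [v c u u'|u c v v']; rewrite /f; last by rewrite linearPr.
  by rewrite mulrDr -scalerAr linearPl.
pose F := bilinear_isBilinear.Build k A A (tensor A A) *:%R *:%R f f_bilinear.
pose g : {bilinear A -> A -> tensor A A} := HB.pack f F.
exact: (tensor_eval_pure g).
Qed.

Lemma ract_pure a x y : ract (pure x y) a = pure x (y * a).
Proof.
pose f x y : tensor A A := pure x (y * a).
have f_bilinear : bilinear_for *:%R *:%R f.
  split=> [v c u u'|u c v v']; rewrite /f; first by rewrite linearPl.
  by rewrite mulrDl -scalerAl linearPr.
pose F := bilinear_isBilinear.Build k A A (tensor A A) *:%R *:%R f f_bilinear.
pose g : {bilinear A -> A -> tensor A A} := HB.pack f F.
exact: (tensor_eval_pure g).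
Qed.

Definition open_Frobenius_coproduct (D : {linear A -> tensor A A}) : Prop :=
  forall a b, D (a * b) = lact a (D b) /\ D (a * b) = ract (D a) b.

Definition Frobenius_dimension (n : nat) : Prop :=
  exists D : 'I_n -> {linear A -> tensor A A},
  [/\ forall i, open_Frobenius_coproduct (D i),
      forall c : 'I_n -> k,
        (forall a, \sum_i c i *: D i a = 0) -> forall i, c i = 0
    & forall D', open_Frobenius_coproduct D' ->
        exists c : 'I_n -> k, forall a, D' a = \sum_i c i *: D i a].

Definition finite_Frobenius_dimension : Prop := exists n, Frobenius_dimension n.

End Frobenius.

Record category (ob : Type) := Category {
  mor : ob -> ob -> Type;
  idm : forall X, mor X X;
  cmp : forall X Y Z, mor Y Z -> mor X Y -> mor X Z;
  cmp1m : forall X Y (f : mor X Y), cmp (idm Y) f = f;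
  cmpm1 : forall X Y (f : mor X Y), cmp f (idm X) = f;
  cmpA : forall X Y Z T (h : mor Z T) (g : mor Y Z) (f : mor X Y),
    cmp h (cmp g f) = cmp (cmp h g) f }.

Definition is_iso (ob : Type) (C : category ob) X Y (f : mor C X Y) : Prop :=
  exists g : mor C Y X, cmp g f = idm C X /\ cmp f g = idm C Y.

Definition is_functor (ob ob' : Type) (C : category ob) (D : category ob')
    (F : ob -> ob') (G : forall X Y, mor C X Y -> mor D (F X) (F Y)) : Prop :=
  (forall X, G X X (idm C X) = idm D (F X)) /\
  (forall X Y Z (g : mor C Y Z) (f : mor C X Y),
     G _ _ (cmp g f) = cmp (G _ _ g) (G _ _ f)).

(* [C] and [D] have the same objects and [L] is the identity on them, as for the
   Gabriel-Zisman category of fractions. *)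
Definition is_localization (ob : Type) (C : category ob)
    (W : forall X Y, mor C X Y -> Prop) (D : category ob)
    (L : forall X Y, mor C X Y -> mor D X Y) : Prop :=
  [/\ is_functor (F := id) L,
      forall X Y (f : mor C X Y), W _ _ f -> is_iso (L _ _ f)
    & forall (ob' : Type) (E : category ob') (F : ob -> ob')
        (G : forall X Y, mor C X Y -> mor E (F X) (F Y)),
      is_functor G ->
      (forall X Y (f : mor C X Y), W _ _ f -> is_iso (G _ _ f)) ->
      exists2 G' : forall X Y, mor D X Y -> mor E (F X) (F Y),
        is_functor G' /\ (forall X Y f, G' X Y (L _ _ f) = G _ _ f)
      & forall G'' : forall X Y, mor D X Y -> mor E (F X) (F Y),
        is_functor G'' -> (forall X Y f, G'' X Y (L _ _ f) = G _ _ f) ->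
        forall X Y f, G'' X Y f = G' X Y f].

Record lincat (k : fieldType) (ob : Type) := Lincat {
  hom : ob -> ob -> lmodType k;
  id1 : forall X, hom X X;
  comp : forall X Y Z, hom Y Z -> hom X Y -> hom X Z;
  comp1m : forall X Y (f : hom X Y), comp (id1 Y) f = f;
  compm1 : forall X Y (f : hom X Y), comp f (id1 X) = f;
  compA : forall X Y Z T (h : hom Z T) (g : hom Y Z) (f : hom X Y),
    comp h (comp g f) = comp (comp h g) f;
  comp_bilinear : forall X Y Z, bilinear_for *:%R *:%R (@comp X Y Z) }.

Notation "g '\oc' f" := (comp g f) (at level 40, left associativity).

Section LinearCategories.
Variable k : fieldType.

Section Comp.
Variables (ob : Type) (C : lincat k ob).

HB.instance Definition _ X Y Z :=
  bilinear_isBilinear.Build k (hom C Y Z) (hom C X Y) (hom C X Z)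
    *:%R *:%R (@comp k ob C X Y Z) (@comp_bilinear k ob C X Y Z).

Definition category_of_lincat : category ob :=
  Category (@comp1m k ob C) (@compm1 k ob C) (@compA k ob C).

End Comp.

Coercion category_of_lincat : lincat >-> category.

Record linfunctor (ob ob' : Type) (C : lincat k ob) (D : lincat k ob')
    (F : ob -> ob') := Linfunctor {
  fmap :> forall X Y, {linear hom C X Y -> hom D (F X) (F Y)};
  fmap1 : forall X, fmap X X (id1 C X) = id1 D (F X);
  fmap_comp : forall X Y Z (g : hom C Y Z) (f : hom C X Y),
    fmap _ _ (g \oc f) = fmap _ _ g \oc fmap _ _ f }.

Section Functors.
Variables (ob ob' ob'' : Type).
Variables (C : lincat k ob) (D : lincat k ob') (E : lincat k ob'').

Definition linfunctor_id : linfunctor C C id :=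
  @Linfunctor _ _ C C id (fun X Y => idfun) (fun=> erefl) (fun _ _ _ _ _ => erefl).

Program Definition linfunctor_comp G F (S : linfunctor D E G)
    (T : linfunctor C D F) : linfunctor C E (G \o F) :=
  @Linfunctor _ _ C E (G \o F) (fun X Y => S _ _ \o T X Y) _ _.
Next Obligation. by rewrite !fmap1. Qed.
Next Obligation. by rewrite !fmap_comp. Qed.

Definition natural F G (S : linfunctor C D F) (T : linfunctor C D G)
    (eta : forall X, hom D (F X) (G X)) : Prop :=
  forall X Y (f : hom C X Y), T _ _ f \oc eta X = eta Y \oc S _ _ f.

Definition natural_iso F G (S : linfunctor C D F) (T : linfunctor C D G)
    (eta : forall X, hom D (F X) (G X)) : Prop :=
  natural S T eta /\ forall X, is_iso (C := D) (eta X).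

Definition isomorphic_functors F G (S : linfunctor C D F) (T : linfunctor C D G) :=
  exists eta, natural_iso S T eta.

End Functors.

Definition quasi_inverse ob ob' (C : lincat k ob) (D : lincat k ob') F G
    (S : linfunctor C D F) (T : linfunctor D C G) : Prop :=
  isomorphic_functors (linfunctor_comp T S) (linfunctor_id C) /\
  isomorphic_functors (linfunctor_comp S T) (linfunctor_id D).

(* The powers [F^n], [n : int], of an autoequivalence [F = F^1]: such an [F] is
   in general only invertible up to isomorphism, so that one has to choose
   [F^n] together with coherent isomorphisms [F^i F^j ~ F^(i+j)] and
   [1 ~ F^0].  The indices are tied by proofs of [i + j = n] (resp. [i = 0])
   in order to avoid transports. *)
Record zpowers (ob : Type) (D : lincat k ob) := Zpowers {
  zob : int -> ob -> ob;
  zfun : forall n, linfunctor D D (zob n);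
  zmul : forall i j n, i + j = n -> forall X, hom D (zob i (zob j X)) (zob n X);
  zone : forall n, n = 0 -> forall X, hom D X (zob n X);
  zmul_iso : forall i j n (e : i + j = n),
    natural_iso (linfunctor_comp (zfun i) (zfun j)) (zfun n) (zmul e);
  zone_iso : forall n (e : n = 0),
    natural_iso (linfunctor_id D) (zfun n) (zone e);
  zmulA : forall i j l m q n (e1 : i + j = m) (e2 : m + l = n)
      (e3 : j + l = q) (e4 : i + q = n) X,
    zmul e2 X \oc zmul e1 (zob l X) = zmul e4 X \oc zfun i _ _ (zmul e3 X);
  zmul1 : forall i n (e : n = 0) (e' : i + n = i) X,
    zmul e' X \oc zfun i _ _ (zone e X) = id1 D (zob i X);
  zmul1l : forall i n (e : n = 0) (e' : n + i = i) X,
    zmul e' X \oc zone e (zob i X) = id1 D (zob i X) }.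

End LinearCategories.

Section Orbit.
Variables (k : fieldType) (ob : Type) (D : lincat k ob) (F : zpowers D).

Definition finitely_supported X Y (f : forall i, hom D X (zob F i Y)) : Prop :=
  exists S : {fset int}, forall i, i \notin S -> f i = 0.

(* The direct sum over [i] of the [Hom_D(X, F^i Y)]. *)
Record orbit_hom (X Y : ob) := OrbitHom {
  ocoef :> forall i, hom D X (zob F i Y);
  ocoef_fin : finitely_supported ocoef }.

Lemma orbit_hom_eq X Y (f g : orbit_hom X Y) : (forall i, f i = g i) -> f = g.
Proof.
case: f g => [f pf] [g pg] /= h.
have e : f = g by apply: functional_extensionality_dep.
by subst g; rewrite (Prop_irrelevance pf pg).
Qed.

HB.instance Definition _ X Y := gen_eqMixin (orbit_hom X Y).
HB.instance Definition _ X Y := gen_choiceMixin (orbit_hom X Y).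

Fact ohom0_fin X Y : @finitely_supported X Y (fun i => 0).
Proof. by exists fset0. Qed.
Definition ohom0 X Y : orbit_hom X Y := OrbitHom (@ohom0_fin X Y).

Fact ohom_lin_fin X Y (a : k) (f g : orbit_hom X Y) :
  finitely_supported (fun i => a *: f i + g i).
Proof.
case: f g => [f [S hS]] [g [T hT]] /=; exists (S `|` T)%fset => i.
by rewrite inE negb_or => /andP[/hS -> /hT ->]; rewrite scaler0 addr0.
Qed.
Definition ohom_lin X Y a (f g : orbit_hom X Y) : orbit_hom X Y :=
  OrbitHom (ohom_lin_fin a f g).
Definition ohom_add X Y := @ohom_lin X Y 1.
Definition ohom_scale X Y a (f : orbit_hom X Y) := ohom_lin a f (ohom0 X Y).

Fact ohom_addA X Y : associative (@ohom_add X Y).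
Proof. by move=> f g h; apply: orbit_hom_eq => i /=; rewrite !scale1r addrA. Qed.
Fact ohom_addC X Y : commutative (@ohom_add X Y).
Proof. by move=> f g; apply: orbit_hom_eq => i /=; rewrite !scale1r addrC. Qed.
Fact ohom_add0 X Y : left_id (ohom0 X Y) (@ohom_add X Y).
Proof. by move=> f; apply: orbit_hom_eq => i /=; rewrite scale1r add0r. Qed.
Fact ohom_addN X Y :
  left_inverse (ohom0 X Y) (@ohom_scale X Y (-1)) (@ohom_add X Y).
Proof.
by move=> f; apply: orbit_hom_eq => i /=; rewrite scale1r scaleN1r addr0 addNr.
Qed.
HB.instance Definition _ X Y := GRing.isZmodule.Build (orbit_hom X Y)
  (@ohom_addA X Y) (@ohom_addC X Y) (@ohom_add0 X Y) (@ohom_addN X Y).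

Fact ohom_scaleA X Y a b (f : orbit_hom X Y) :
  ohom_scale a (ohom_scale b f) = ohom_scale (a * b) f.
Proof. by apply: orbit_hom_eq => i /=; rewrite !addr0 scalerA. Qed.
Fact ohom_scale1 X Y : left_id 1 (@ohom_scale X Y).
Proof. by move=> f; apply: orbit_hom_eq => i /=; rewrite scale1r addr0. Qed.
Fact ohom_scaleDr X Y : right_distributive (@ohom_scale X Y) +%R.
Proof.
by move=> a f g; apply: orbit_hom_eq => i /=; rewrite !addr0 !scale1r scalerDr.
Qed.
Fact ohom_scaleDl X Y (f : orbit_hom X Y) :
  {morph (@ohom_scale X Y)^~ f : a b / a + b}.
Proof.
by move=> a b; apply: orbit_hom_eq => i /=; rewrite !addr0 scale1r scalerDl.
Qed.
HB.instance Definition _ X Y := GRing.Zmodule_isLmodule.Build k (orbit_hom X Y)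
  (@ohom_scaleA X Y) (@ohom_scale1 X Y) (@ohom_scaleDr X Y) (@ohom_scaleDl X Y).

Lemma ocoefD X Y (f g : orbit_hom X Y) i : (f + g) i = f i + g i.
Proof. by rewrite /= scale1r. Qed.
Lemma ocoefZ X Y a (f : orbit_hom X Y) i : (a *: f) i = a *: f i.
Proof. by rewrite /= addr0. Qed.

Definition oid_coef X (i : int) : hom D X (zob F i X) :=
  match @eqP _ i 0 with
  | ReflectT e => zone F e X
  | ReflectF _ => 0
  end.

Fact oid_fin X : finitely_supported (oid_coef X).
Proof.
exists [fset 0]%fset => i; rewrite inE => /negP ni; rewrite /oid_coef.
by case: eqP => // e; case: ni; rewrite e.
Qed.
Definition oid X : orbit_hom X X := OrbitHom (@oid_fin X).

Fact subKC (i n : int) : i + (n - i) = n. Proof. by rewrite addrC subrK. Qed.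

(* [g \o f] in degree [n] is the sum over [i] of
   [X --f_i--> F^i Y --F^i(g_(n-i))--> F^i F^(n-i) Z ~ F^n Z]. *)
Definition oterm X Y Z (g : forall i, hom D Y (zob F i Z))
    (f : forall i, hom D X (zob F i Y)) n i : hom D X (zob F n Z) :=
  zmul F (subKC i n) Z \oc zfun F i _ _ (g (n - i)) \oc f i.

Definition ocomp_coef X Y Z (g : orbit_hom Y Z) (f : orbit_hom X Y) n :
    hom D X (zob F n Z) :=
  \sum_(i \in [set: int]) oterm g f n i.

Let comp0r X Y Z (g : hom D Y Z) : g \oc 0 = 0 :> hom D X Z.
Proof. exact: linear0r. Qed.
Let comp0l X Y Z (f : hom D X Y) : 0 \oc f = 0 :> hom D X Z.
Proof. exact: linear0l. Qed.
Let compDr X Y Z (g : hom D Y Z) (f f' : hom D X Y) :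
  g \oc (f + f') = g \oc f + g \oc f'.
Proof. exact: linearDr. Qed.
Let compDl X Y Z (g g' : hom D Y Z) (f : hom D X Y) :
  (g + g') \oc f = g \oc f + g' \oc f.
Proof. exact: linearDl. Qed.
Let compZr X Y Z a (g : hom D Y Z) (f : hom D X Y) :
  g \oc (a *: f) = a *: (g \oc f).
Proof. exact: linearZr_LR. Qed.
Let compZl X Y Z a (g : hom D Y Z) (f : hom D X Y) :
  (a *: g) \oc f = a *: (g \oc f).
Proof. exact: linearZl_LR. Qed.
Let comp_sumr X Y Z (g : hom D Y Z) (I : Type) (r : seq I) (f : I -> hom D X Y) :
  g \oc (\sum_(i <- r) f i) = \sum_(i <- r) g \oc f i.
Proof. exact: linear_sumr. Qed.
Let comp_suml X Y Z (f : hom D X Y) (I : Type) (r : seq I) (g : I -> hom D Y Z) :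
  (\sum_(i <- r) g i) \oc f = \sum_(i <- r) g i \oc f.
Proof. exact: linear_sumlz. Qed.

Lemma oterm0r X Y Z g (f : forall i, hom D X (zob F i Y)) n i :
  f i = 0 -> @oterm X Y Z g f n i = 0.
Proof. by rewrite /oterm => ->; rewrite comp0r. Qed.

Lemma oterm0l X Y Z (g : forall i, hom D Y (zob F i Z)) f n i :
  g (n - i) = 0 -> @oterm X Y Z g f n i = 0.
Proof. by rewrite /oterm => ->; rewrite linear0 comp0r comp0l. Qed.

Lemma ocomp_coefE X Y Z (g : orbit_hom Y Z) (f : orbit_hom X Y) n (S : {fset int}) :
  (forall i, i \notin S -> f i = 0) ->
  ocomp_coef g f n = \sum_(i <- S) oterm g f n i.
Proof.
by move=> hS; rewrite /ocomp_coef (@fsbigTE _ _ _ _ S) // => i /hS; apply: oterm0r.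
Qed.

Fact ocomp_fin X Y Z (g : orbit_hom Y Z) (f : orbit_hom X Y) :
  finitely_supported (ocomp_coef g f).
Proof.
have [S hS] := ocoef_fin f; have [T hT] := ocoef_fin g.
exists [fset (i + j)%R | i in S, j in T]%fset => n hn.
rewrite (ocomp_coefE _ _ hS); apply: big1_seq => i /andP[_ iS].
apply: oterm0l; apply: hT; apply: contra hn => jT.
by apply/imfset2P; exists i => //; exists (n - i) => //; rewrite subKC.
Qed.
Definition ocomp X Y Z (g : orbit_hom Y Z) (f : orbit_hom X Y) : orbit_hom X Z :=
  OrbitHom (ocomp_fin g f).

Fact ocomp1m X Y (f : orbit_hom X Y) : ocomp (oid Y) f = f.
Proof.
apply: orbit_hom_eq => n /=; rewrite /ocomp_coef (@fsbigTE _ _ _ _ [fset n]%fset).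
  rewrite big_seq_fset1 /oterm /= /oid_coef; case: eqP => [e|ne]; last by case: ne; rewrite subrr.
  by rewrite zmul1 comp1m.
move=> i; rewrite inE => /eqP ni; apply: oterm0l; rewrite /= /oid_coef.
by case: eqP => // e; case: ni; apply/esym/eqP; rewrite -subr_eq0 e.
Qed.

Fact ocompm1 X Y (f : orbit_hom X Y) : ocomp f (oid X) = f.
Proof.
apply: orbit_hom_eq => n /=; rewrite /ocomp_coef (@fsbigTE _ _ _ _ [fset 0]%fset).
  rewrite big_seq_fset1 /oterm /= /oid_coef; case: eqP => // e.
  have [nat_one _] := @zone_iso _ _ _ F 0 e.
  rewrite -compA nat_one compA; move: (subKC 0 n).
  have -> : n - 0 = n by rewrite subr0.
  by move=> e'; rewrite zmul1l comp1m.
move=> i; rewrite inE => /eqP ni; apply: oterm0r; rewrite /= /oid_coef.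
by case: eqP.
Qed.

Fact ocomp_bilinear X Y Z : bilinear_for *:%R *:%R (@ocomp X Y Z).
Proof.
split=> [f a g g'|g a f f']; apply: orbit_hom_eq => n;
  rewrite ocoefD ocoefZ /=.
  have [S hS] := ocoef_fin f.
  rewrite !(ocomp_coefE _ _ hS) scaler_sumr -big_split; apply: eq_bigr => i _ /=.
  rewrite /oterm addr0 scale1r linearD linearZ /=.
  by rewrite compDr compDl compZr compZl.
have [S hS] := ocoef_fin f; have [S' hS'] := ocoef_fin f'.
have hf i : i \notin (S `|` S')%fset -> f i = 0.
  by rewrite inE negb_or => /andP[/hS].
have hf' i : i \notin (S `|` S')%fset -> f' i = 0.
  by rewrite inE negb_or => /andP[_ /hS'].
rewrite (ocomp_coefE _ _ hf) (ocomp_coefE _ _ hf') (@ocomp_coefE _ _ _ _ _ _ (S `|` S')%fset).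
  rewrite scaler_sumr -big_split; apply: eq_bigr => i _ /=.
  by rewrite /oterm /= addr0 scale1r compDr compZr.
by move=> i hi; rewrite ocoefD ocoefZ hf // hf' // scaler0 addr0.
Qed.

Let assoc_term X Y Z T (h : forall i, hom D Z (zob F i T))
    (g : forall i, hom D Y (zob F i Z)) (f : forall i, hom D X (zob F i Y))
    i j j' l l' m q n (e1 : i + j = m) (e2 : m + l = n) (e3 : j' + l' = q)
    (e4 : i + q = n) : j = j' -> l = l' ->
  zmul F e2 T \oc zfun F m _ _ (h l) \oc (zmul F e1 Z \oc zfun F i _ _ (g j) \oc f i)
  = zmul F e4 T \oc zfun F i _ _ (zmul F e3 T \oc zfun F j' _ _ (h l') \oc g j')
      \oc f i.
Proof.
move=> ej el; subst j' l'.
have [nat_mul _] := zmul_iso F e1.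
rewrite !fmap_comp !compA; congr (_ \oc _ \oc _).
rewrite -(zmulA F e1 e2 e3 e4) -!compA; congr (_ \oc _).
by rewrite (nat_mul _ _ (h l)).
Qed.

Fact ocompA X Y Z T (h : orbit_hom Z T) (g : orbit_hom Y Z) (f : orbit_hom X Y) :
  ocomp h (ocomp g f) = ocomp (ocomp h g) f.
Proof.
have [S hS] := ocoef_fin f; have [R hR] := ocoef_fin g.
pose A := [fset (i + j)%R | i in S, j in R]%fset.
have hA m : m \notin A -> ocomp g f m = 0.
  move=> hm /=; rewrite (ocomp_coefE _ _ hS); apply: big1_seq => i /andP[_ iS].
  apply: oterm0l; apply: hR; apply: contra hm => jR.
  by apply/imfset2P; exists i => //; exists (m - i) => //; rewrite subKC.
apply: orbit_hom_eq => n /=.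
rewrite (ocomp_coefE _ _ hA) (ocomp_coefE _ _ hS) /=.
pose B m i := zmul F (subKC m n) T \oc zfun F m _ _ (h (n - m)) \oc oterm g f m i.
rewrite (eq_bigr (fun m => \sum_(i <- S) B m i)); last first.
  by move=> m _; rewrite /oterm /= (ocomp_coefE _ _ hS) comp_sumr.
rewrite exchange_big; apply: eq_big_seq => i iS.
rewrite -(@fsbigTE _ _ _ _ A); last first.
  move=> m hm; rewrite /B oterm0l ?comp0r //; apply: hR; apply: contra hm => jR.
  by apply/imfset2P; exists i => //; exists (m - i) => //; rewrite subKC.
rewrite (reindex_fsbigT (fun j => i + j)); last first.
  by exists (fun m => - i + m) => j; rewrite addrA ?addNr ?subrr add0r.
rewrite /oterm /= (ocomp_coefE _ _ hR) linear_sum comp_sumr comp_suml.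
rewrite (@fsbigTE _ _ _ _ R); last first.
  move=> j hj; rewrite /B oterm0l ?comp0r //; apply: hR.
  by rewrite addrC addrA addNr add0r.
apply: eq_bigr => j _; rewrite /B /oterm; apply: assoc_term.
  by rewrite addrC addrA addNr add0r.
by rewrite opprD addrA.
Qed.

Definition orbit_category : lincat k ob :=
  @Lincat k ob (fun X Y => orbit_hom X Y) oid ocomp
    ocomp1m ocompm1 ocompA ocomp_bilinear.

End Orbit.

Record quiver := Quiver {
  vertex : finType;
  arrow : finType;
  src : arrow -> vertex;
  tgt : arrow -> vertex }.

Section PathAlgebra.
Variable Q : quiver.

(* A path is given by its source and its list of arrows, read from the source;
   the pair [(v, [::])] is the trivial path at [v]. *)
Fixpoint walk (v : vertex Q) (s : seq (arrow Q)) : bool :=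
  if s is a :: s' then (src a == v) && walk (tgt a) s' else true.

Definition is_path (p : vertex Q * seq (arrow Q)) : bool := walk p.1 p.2.

Definition path_end (p : vertex Q * seq (arrow Q)) : vertex Q :=
  last p.1 [seq tgt a | a <- p.2].

(* [H] is the path algebra of [Q], the basis element of a path [p] being [b p]
   (the values of [b] at pairs which are not paths are irrelevant). *)
Record is_path_algebra (k : fieldType) (H : algType k)
    (b : vertex Q * seq (arrow Q) -> H) : Prop := IsPathAlgebra {
  path_free : forall (S : seq (vertex Q * seq (arrow Q))) c,
    uniq S -> all is_path S -> \sum_(p <- S) c p *: b p = 0 ->
    forall p, p \in S -> c p = 0 :> k;
  path_span : forall h : H, exists S c,
    all is_path S /\ h = \sum_(p <- S) c p *: b p;
  path_mul : forall p q, is_path p -> is_path q ->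
    b p * b q = if path_end p == q.1 then b (p.1, p.2 ++ q.2) else 0;
  path_one : 1 = \sum_v b (v, [::]) }.

(* The underlying graph of [Q] is the Dynkin diagram [D_n], [n >= 4]:
     0 -- 1 -- ... -- n-3 -- n-2,   with n-1 also attached to n-3. *)
Definition D_edge (n i j : nat) : bool :=
  ((j == i.+1) && (j < n.-1)%N) || ((i == n - 3)%N && (j == n.-1)).

Definition Dynkin_D (n : nat) : Prop :=
  (4 <= n)%N /\
  exists2 f : vertex Q -> 'I_n, bijective f &
  forall u v,
    #|[pred a | ((src a == u) && (tgt a == v)) || ((src a == v) && (tgt a == u))]|
    = (D_edge n (f u) (f v) || D_edge n (f v) (f u)) :> nat.

End PathAlgebra.

Section Complexes.
Variables (k : fieldType) (H : algType k).

Record fgmod := Fgmod {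
  fgcar :> lmodType H;
  fgcarP : exists n (e : 'I_n -> fgcar),
    forall x, exists c : 'I_n -> H, x = \sum_i c i *: e i }.

Record cplx := Cplx {
  cx :> int -> fgmod;
  cdiff : forall i, {linear cx i -> cx (i + 1)};
  cdiffK : forall i x, cdiff (i + 1) (cdiff i x) = 0;
  cbounded : exists N : nat, forall i, (N < `|i|)%N -> forall x : cx i, x = 0 }.

Record chain_map (X Y : cplx) := ChainMap {
  cmap :> forall i, {linear X i -> Y i};
  cmapP : forall i x, cdiff Y i (cmap i x) = cmap (i + 1) (cdiff X i x) }.

Lemma chain_map_eq X Y (f g : chain_map X Y) : (forall i, f i =1 g i) -> f = g.
Proof.
case: f g => [f pf] [g pg] /= h.
have e : f = g.
  apply: functional_extensionality_dep => i.
  have := functional_extensionality_dep (h i).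
  case: (f i) (g i) => [u [[u1] [u2]]] [v [[v1] [v2]]] /= uv.
  by subst v; rewrite (Prop_irrelevance u1 v1) (Prop_irrelevance u2 v2).
by subst g; rewrite (Prop_irrelevance pf pg).
Qed.

Definition chain_id X : chain_map X X :=
  @ChainMap X X (fun i => idfun) (fun i x => erefl).

Program Definition chain_comp X Y Z (g : chain_map Y Z) (f : chain_map X Y) :
    chain_map X Z :=
  @ChainMap X Z (fun i => g i \o f i) _.
Next Obligation. by rewrite /= cmapP cmapP. Qed.

Program Definition complexes : category cplx :=
  @Category cplx chain_map chain_id chain_comp _ _ _.
Next Obligation. exact: chain_map_eq. Qed.
Next Obligation. exact: chain_map_eq. Qed.
Next Obligation. exact: chain_map_eq. Qed.

(* [f] induces a bijection between the cohomologies of [X] and [Y] in every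
   degree; writing the degree as [i + 1] gives boundaries the right type. *)
Definition quasi_iso X Y (f : mor complexes X Y) : Prop :=
  forall i,
    (forall x : X (i + 1), cdiff X (i + 1) x = 0 ->
       (exists y, cdiff Y i y = f (i + 1) x) -> exists w, cdiff X i w = x) /\
    (forall y : Y (i + 1), cdiff Y (i + 1) y = 0 ->
       exists2 x : X (i + 1), cdiff X (i + 1) x = 0 &
         exists w, cdiff Y i w = y - f (i + 1) x).

Program Definition shift (X : cplx) : cplx :=
  @Cplx (fun i => X (i + 1)) (fun i => \- cdiff X (i + 1)) _ _.
Next Obligation. by rewrite linearN cdiffK !oppr0. Qed.
Next Obligation.
have [N hN] := cbounded X; exists N.+1 => i hi; apply: hN; lia.
Qed.

Program Definition shift_map X Y (f : chain_map X Y) :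
    chain_map (shift X) (shift Y) :=
  @ChainMap (shift X) (shift Y) (fun i => f (i + 1)) _.
Next Obligation. by rewrite cmapP linearN. Qed.

(* The localization of the category of bounded complexes of finitely generated
   [H]-modules at quasi-isomorphisms, with its [k]-linear structure and the
   induced shift functor. The field [k] acts on [H]-modules through [a%:A]. *)
Record derived_category := DerivedCategory {
  dcat :> lincat k cplx;
  dloc : forall X Y, chain_map X Y -> hom dcat X Y;
  dlocP : is_localization (C := complexes) quasi_iso (D := dcat) dloc;
  dloc_linear : forall X Y (a : k) (f g h : chain_map X Y),
    (forall i x, h i x = a%:A *: f i x + g i x) ->
    dloc h = a *: dloc f + dloc g;
  dshift : linfunctor dcat dcat shift;
  dshift_loc : forall X Y (f : chain_map X Y),
    dshift _ _ (dloc f) = dloc (shift_map f) }.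

(* Auslander-Reiten duality: isomorphisms [Hom(X, Y[1]) ~ D Hom(Y, tau X)],
   natural in [X] and [Y], where [D] is the [k]-dual. *)
Definition AR_duality (D : derived_category) (tau0 : cplx -> cplx)
    (tau : linfunctor D D tau0) : Prop :=
  exists ar : forall X Y,
    hom D X (shift Y) -> {linear hom D Y (tau0 X) -> k^o},
  [/\ forall X Y, bijective (ar X Y),
      forall X Y a f f' g,
        ar X Y (a *: f + f') g = a *: ar X Y f g + ar X Y f' g,
      forall X X' Y (u : hom D X' X) f g,
        ar X' Y (f \oc u) g = ar X Y f (tau _ _ u \oc g)
    & forall X Y Y' (v : hom D Y Y') f g,
        ar X Y' (dshift D _ _ v \oc f) g = ar X Y f (g \oc v)].

(* The Auslander-Reiten translation is the autoequivalence [tau] (with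
   quasi-inverse [tauV]) subject to Auslander-Reiten duality, which determines
   it up to isomorphism. *)
Record cluster_data := ClusterData {
  cderived : derived_category;
  tau0 : cplx -> cplx;
  tau : linfunctor cderived cderived tau0;
  tauV0 : cplx -> cplx;
  tauV : linfunctor cderived cderived tauV0;
  tauVP : quasi_inverse tau tauV;
  tauP : AR_duality tau;
  cpowers : zpowers cderived;
  cpowersP : isomorphic_functors (zfun cpowers 1)
               (linfunctor_comp tauV (dshift cderived)) }.

Definition cluster_category (C : cluster_data) : lincat k cplx :=
  orbit_category (cpowers C).

End Complexes.

Section Additive.
Variables (k : fieldType) (ob : Type) (C : lincat k ob).

Definition is_direct_sum (I : finType) (X : I -> ob) (S : ob) : Prop :=
  exists (inj : forall i, hom C (X i) S) (proj : forall i, hom C S (X i)),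
  [/\ forall i, proj i \oc inj i = id1 C (X i),
      forall i j, i != j -> proj j \oc inj i = 0
    & \sum_i inj i \oc proj i = id1 C S].

Definition is_sum2 (X Y S : ob) : Prop :=
  is_direct_sum (fun b : bool => if b then X else Y) S.

(* [X] is a direct summand of a finite direct sum of copies of [T]. *)
Definition in_add (T X : ob) : Prop :=
  exists n S X', is_direct_sum (fun _ : 'I_n => T) S /\ is_sum2 X X' S.

End Additive.

Section ClusterTilted.
Variables (k : fieldType) (H : algType k) (D : cluster_data H).
Let C := cluster_category D.

Definition Ext1_vanishes (X Y : cplx H) : Prop :=
  forall f : hom C X (shift Y), f = 0.

Definition tilting_object (T : cplx H) : Prop :=
  Ext1_vanishes T T /\
  forall X S, is_sum2 C T X S -> Ext1_vanishes S S -> in_add C T X.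

Definition is_End_algebra (T : cplx H) (A : algType k) : Prop :=
  exists phi : {linear A -> hom C T T},
  [/\ bijective phi, phi 1 = id1 C T
    & forall a b, phi (a * b) = phi a \oc phi b].

End ClusterTilted.

Definition cluster_tilted_of (k : fieldType) (Q : quiver) (A : algType k) : Prop :=
  exists (H : algType k) (b : vertex Q * seq (arrow Q) -> H),
    is_path_algebra b /\
    exists (D : cluster_data H) (T : cplx H),
      tilting_object D T /\ is_End_algebra D T A.

Definition cluster_tilted_type_D (k : fieldType) (A : algType k) : Prop :=
  exists (n : nat) (Q : quiver), Dynkin_D Q n /\ cluster_tilted_of Q A.

(* Main.v *)
(* An algebra [A] of finite dimension has finite Frobenius dimension, so it is enough
   to bound [Hom_C(T, T)], the direct sum over [i] of the [Hom_D(T, F^i T)].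

   The path algebra [H] of a Dynkin quiver of type D is finite-dimensional, and every
   bounded complex [X] of [H]-modules has a functorial resolution by injectives of
   length one, the coresolution [0 -> X -> Hom_E(H, X) -> prod_a Hom_k(H, X) -> 0]
   relative to the span [E] of the idempotents.  Its total complex [J X] is
   K-injective, so that the universal property of the localization forces every
   morphism [Y -> J X] of the derived category to come from a chain map.  Hence each
   [Hom_D(Y, X[1])] is finite-dimensional, and it vanishes when [Y] lives in degrees
   [> a] and [X] in degrees [<= a]: this is the hereditary property.

   If [Z] lives in degrees [<= a] and [W] in degrees [>= a], Auslander-Reiten duality
   gives, for [F Z = tau^-1 Z[1]],
   [Hom(F Z, W) = Hom(Z[1], tau W) = D Hom(W, Z[2]) = 0], whence [F Z] is isomorphic
   to a complex in degrees [<= a - 1].  Thus [F^n T] drifts to the left and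
   [Hom_D(T, F^n T) = Hom_D(tau T, F^(n-1) T[1])] vanishes for large [n], while
   [Hom_D(F^n T, T)] is dual to [Hom_D(tau^-1 T, F^n T[1])] and vanishes as well. *)

From HB Require Import structures.
From mathcomp Require Import all_boot all_order all_algebra.
From mathcomp Require Import generic_quotient zify boolp classical_sets.
Require Import Defs.

Set Implicit Arguments.
Unset Strict Implicit.
Unset Printing Implicit Defensive.

(** * Paths of a Dynkin quiver of type D *)

Section DynkinPaths.
Variables (Q : quiver) (n : nat).

Lemma D_edge_lt i j : 4 <= n -> D_edge n i j -> i < n -> j < n -> i < j.
Proof. by rewrite /D_edge; lia. Qed.

Lemma D_edge_inj i i' j : D_edge n i j -> D_edge n i' j -> i = i'.
Proof. by rewrite /D_edge; lia. Qed.

Hypothesis QD : Dynkin_D Q n.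

(** The labelled diagram is a tree in which every vertex has at most one lower neighbour, so a walk,
    whatever the orientation, first descends and then ascends. *)
Lemma Dynkin_D_walk_bounded : exists N, forall (v : vertex Q) s, walk v s -> size s <= N.
Proof.
have [n4 [f [g fK gK] fE]] := QD.
have edge (a : arrow Q) :
    D_edge n (f (src a)) (f (tgt a)) || D_edge n (f (tgt a)) (f (src a)).
  (* The number of arrows between two vertices is 0 or 1; it is positive here since it counts
     [a]. *)
  rewrite -[_ || _]lt0b -fE; apply/card_gt0P; exists a.
  by rewrite inE !eqxx.
(* Two opposite arrows would be counted twice, and an arrow opposite to itself would be a loop,
   whereas adjacent labels differ. *)
have noback (a a' : arrow Q) : src a' = tgt a -> tgt a' = src a -> False.
  move=> e e'; have := fE (src a) (tgt a).
  have [eqa|neqa] := eqVneq a a'.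
    move: (edge a); rewrite -e -eqa orbb => h.
    by have := D_edge_lt n4 h (ltn_ord _) (ltn_ord _); rewrite ltnn.
  suff : 2 <= #|[pred a0 | ((src a0 == src a) && (tgt a0 == tgt a))
                       || ((src a0 == tgt a) && (tgt a0 == src a))]|.
    by move=> h E; move: h; rewrite E; case: (_ || _).
  have <- : #|pred2 a a'| = 2 by rewrite card2 neqa.
  apply/subset_leq_card/fintype.subsetP => c /[!inE] /orP[] /eqP ->;
    by rewrite ?e ?e' !eqxx ?orbT.
(* After an ascending step the next one ascends too: by [D_edge_inj] a descending step would return
   to the vertex just left, against [noback]. *)
have up a s : D_edge n (f (src a)) (f (tgt a)) -> walk (tgt a) s ->
    size s + f (tgt a) < n.
  elim: s a => [|c s IH] a ha /=; first by rewrite ltn_ord.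
  move=> /andP[/eqP sc wc]; have /orP[hc|hc] := edge c.
    have := IH c hc wc; have := D_edge_lt n4 hc (ltn_ord _) (ltn_ord _).
    by rewrite sc; lia.
  rewrite sc in hc; have /val_inj/(can_inj fK) e := D_edge_inj ha hc.
  by case: (noback a c).
(* At most [f v] descending steps are possible from [v], followed by at most [n] ascending ones. *)
exists (n + n) => v s ws; suff : size s <= f v + n.
  by have := ltn_ord (f v); lia.
elim: s v ws => [//|a s IH] v /= /andP[/eqP sa wa]; have /orP[ha|ha] := edge a.
  by have := up a s ha wa; lia.
have := IH _ wa; have := D_edge_lt n4 ha (ltn_ord _) (ltn_ord _).
by rewrite sa; lia.
Qed.

Fixpoint seqs_upto (T : finType) N : seq (seq T) :=
  if N is N'.+1 then [::] :: [seq a :: s | a <- enum T, s <- seqs_upto T N'] else [:: [::]].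

Lemma mem_seqs_upto (T : finType) N (s : seq T) : size s <= N -> s \in seqs_upto T N.
Proof.
elim: N s => [|N IH] [|a s] //= sN; rewrite inE; apply/orP; right.
by apply: allpairs_f; rewrite ?mem_enum ?IH.
Qed.

Lemma Dynkin_D_paths :
  exists L : seq (vertex Q * seq (arrow Q)), forall p, is_path p -> p \in L.
Proof.
have [N hN] := Dynkin_D_walk_bounded.
exists [seq (v, s) | v <- enum (vertex Q), s <- seqs_upto (arrow Q) N]; move=> [v s] ws.
by apply: allpairs_f; rewrite ?mem_enum // mem_seqs_upto // (hN v).
Qed.

End DynkinPaths.

Import GRing.Theory.
Local Open Scope ring_scope.
Local Open Scope classical_set_scope.

(** * Linear algebra in arbitrary dimension *)

Section LinearOf.
Variables (R : nzRingType) (V W : lmodType R).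

(** The proof of linearity is an argument, so that a bare function acquires the linear structure by
    unification. *)
Definition linear_of_fun (f : V -> W) (_ : linear f) : V -> W := f.
HB.instance Definition _ f fP :=
  GRing.isLinear.Build R V W *:%R (@linear_of_fun f fP) fP.
Definition mklin f fP : {linear V -> W} := @linear_of_fun f fP.

Lemma linearN_inj (f : {linear V -> W}) :
  (forall x, f x = 0 -> x = 0) -> injective f.
Proof. by move=> h x y e; apply/eqP; rewrite -subr_eq0 (h (x - y)) ?linearB ?e ?subrr. Qed.

End LinearOf.

Section Subspaces.
Variables (k : fieldType).

Definition subspace (V : lmodType k) (U : V -> Prop) :=
  U 0 /\ forall a x y, U x -> U y -> U (a *: x + y).

(** Zorn's lemma for the subspaces that meet [U] trivially: a vector outside [U + C] could be added
    to a maximal [C]. *)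
Lemma exists_complement (V : lmodType k) (U : V -> Prop) : subspace U ->
  exists C : V -> Prop, [/\ subspace C, forall x, U x -> C x -> x = 0
    & forall x, exists u c, [/\ U u, C c & x = u + c]].
Proof.
move=> [U0 Ulin].
(* [P] does not ask for 0, so that the union of the empty chain satisfies it; a maximal set is
   nonempty because the singleton of 0 qualifies. *)
pose P : set (set V) := fun C => (forall a x y, C x -> C y -> C (a *: x + y)) /\
  (forall x, U x -> C x -> x = 0).
have [|C [[Clin CU] Cmax]] := @Zorn_bigcup V P.
  move=> F FP Ftot; split=> [a x y [X FX Xx] [Y FY Yy]|x Ux [X FX Xx]]; last first.
    by have [_ h] := FP _ FX; apply: h.
  have [XY|YX] := Ftot _ _ FX FY.
    by exists Y => //; have [h _] := FP _ FY; apply: h => //; apply: XY.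
  by exists X => //; have [h _] := FP _ FX; apply: h => //; apply: YX.
have C0 : C 0.
  apply: contrapT => nC0.
  have Cempty x : ~ C x.
    by move=> Cx; apply: nC0; have := Clin (-1) x x Cx Cx; rewrite scaleN1r addNr.
  refine (Cmax [set 0] _ _); first split.
  - by move=> x /Cempty.
  - by move=> h; have := h 0 erefl; apply: Cempty.
  - by split=> [a x y -> ->|x _ ->//]; rewrite scaler0 addr0.
exists C; split=> // x; apply: contrapT => nx.
pose B : set V := fun y => exists c a, C c /\ y = c + a *: x.
refine (Cmax B _ _); first split.
- by move=> c Cc; exists c, 0; rewrite scale0r addr0.
- move=> h; apply: nx; exists 0, x; split=> //; last by rewrite add0r.
  by apply: h; exists 0, 1; rewrite scale1r add0r.
split.
  move=> a _ _ [c1 [a1 [Cc1 ->]]] [c2 [a2 [Cc2 ->]]].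
  exists (a *: c1 + c2), (a * a1 + a2); split; first exact: Clin.
  by rewrite scalerDr scalerA scalerDl addrACA.
move=> y Uy [c [a [Cc e]]]; have [a0|a0] := eqVneq a 0.
  by move: e; rewrite a0 scale0r addr0 => e; apply: CU; rewrite // e.
case: nx; exists (a^-1 *: y), (- a^-1 *: c); split.
- by rewrite -[_ *: _]addr0; apply: Ulin.
- by rewrite -[_ *: _]addr0; apply: Clin.
- by rewrite e scalerDr scalerA mulVf // scale1r scaleNr addrAC subrr add0r.
Qed.

Lemma exists_projection (V : lmodType k) (U : V -> Prop) : subspace U ->
  exists p : {linear V -> V}, (forall x, U (p x)) /\ (forall x, U x -> p x = x).
Proof.
move=> Usub; have [C [[C0 Clin] CU dec]] := exists_complement Usub.
have [U0 Ulin] := Usub.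
have uniq u c u' c' : U u -> C c -> U u' -> C c' -> u + c = u' + c' -> u = u'.
  move=> Uu Cc Uu' Cc' e; apply/eqP; rewrite -subr_eq0; apply/eqP/CU.
    by rewrite addrC -scaleN1r; apply: Ulin.
  have -> : u - u' = -1 *: c + c'.
    by rewrite scaleN1r; apply/eqP; rewrite subr_eq -addrA [c' + _]addrC -e addrC addrK.
  exact: Clin.
have /choice [p pP] x : exists u, U u /\ exists2 c, C c & x = u + c.
  by have [u [c [? ? ?]]] := dec x; exists u; split=> //; exists c.
have plin : linear p.
  move=> a x y; have [Ux [c Cc ex]] := pP x; have [Uy [c' Cc' ey]] := pP y.
  have [Uz [c'' Cc'' ez]] := pP (a *: x + y).
  apply: (uniq _ c'' _ (a *: c + c')) => //; [exact: Ulin|exact: Clin|].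
  by rewrite -ez addrACA -scalerDr -ex -ey.
exists (mklin plin); split=> x /=; first by case: (pP x).
move=> Ux; have [Upx [c Cc ex]] := pP x.
by apply: (uniq _ c _ 0) => //; rewrite addr0.
Qed.

(** The values related to [v] form a coset of the subspace [r 0]; a complement of [r 0] meets each
    coset once, and linearly in [v]. *)
Lemma linear_selection (V W : lmodType k) (r : V -> W -> Prop) :
  (forall v, exists w, r v w) ->
  (forall a v v' w w', r v w -> r v' w' -> r (a *: v + v') (a *: w + w')) ->
  exists f : {linear V -> W}, forall v, r v (f v).
Proof.
move=> tot rlin.
have r00 : r 0 0.
  by have [w rw] := tot 0; have := rlin (-1) _ _ _ _ rw rw; rewrite !scaleN1r !addNr.
have [|p [pP pid]] := @exists_projection W (r 0).
  by split=> // a x y rx ry; have := rlin a _ _ _ _ rx ry; rewrite scaler0 add0r.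
have rN v v' w w' : r v w -> r v' w' -> r (v - v') (w - w').
  by move=> h h'; have := rlin (-1) _ _ _ _ h' h; rewrite !scaleN1r ![- _ + _]addrC.
have [g gP] := choice tot.
(* Removing the part in [r 0] makes the result independent of the choice of [g v]. *)
pose f v := g v - p (g v).
have f_eq v w : r v w -> f v = w - p w.
  move=> rw; have := rN _ _ _ _ (gP v) rw; rewrite subrr => /pid; rewrite linearB /= => e.
  by apply/eqP; rewrite -subr_eq0 /f opprB [p w - w]addrC addrACA -e addrACA subrr
    addNr addr0.
have flin : linear f.
  move=> a x y; rewrite (f_eq (a *: x + y) (a *: g x + g y)); last exact: rlin.
  by rewrite linearP /f scalerBr opprD addrACA.
exists (mklin flin) => v /=; rewrite /linear_of_fun /f.
by have := rN _ _ _ _ (gP v) (pP (g v)); rewrite subr0.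
Qed.

(** A preimage of the projection of [w] onto the image of [d] can be selected linearly in [w]. *)
Lemma generalized_inverse (V W : lmodType k) (d : {linear V -> W}) :
  exists r : {linear W -> V}, forall x, d (r (d x)) = d x.
Proof.
have [|p [pP pid]] := @exists_projection W (fun w => exists v, d v = w).
  split=> [|a _ _ [v <-] [v' <-]]; first by exists 0; rewrite linear0.
  by exists (a *: v + v'); rewrite linearP.
have [||f fP] := @linear_selection W V (fun w v => d v = p w).
- exact: pP.
- by move=> a v v' w w' e e'; rewrite !linearP e e'.
- by exists f => x; rewrite fP pid //; exists x.
Qed.

(** A generalized inverse of [a |-> a v] is a functional [r] with [r(v) v = v]. *)
Lemma separating_functional (V : lmodType k) (v : V) :
  (forall f : {linear V -> k^o}, f v = 0) -> v = 0.
Proof.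
move=> h; apply: contrapT => /eqP v0.
pose d (a : k^o) := a *: v.
have dlin : linear d by move=> a x y; rewrite /d scalerDl -scalerA.
have [r rP] := generalized_inverse (mklin dlin).
have := rP 1; rewrite /= /linear_of_fun /d scale1r (h r) scale0r => e.
by rewrite -e eqxx in v0.
Qed.

End Subspaces.

(** * Finite-dimensional vector spaces *)

Section FiniteDimension.
Variables (k : fieldType).
Implicit Types V W : lmodType k.

(** Stated by an embedding, so that no basis has to be chosen and subspaces inherit it by
    composition. *)
Definition fd V := exists n (f : {linear V -> 'rV[k]_n}), injective f.

Lemma fd_inj V W (f : {linear V -> W}) : injective f -> fd W -> fd V.
Proof.
by move=> fi [n [g gi]]; exists n, (g \o f : {linear V -> 'rV[k]_n}); apply: inj_comp.
Qed.

Lemma fd_surj V W (f : {linear V -> W}) :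
  (forall w, exists v, f v = w) -> fd V -> fd W.
Proof.
move=> fs; have [r rP] := generalized_inverse f.
apply: (@fd_inj _ _ r); apply: (can_inj (g := f)) => w.
by have [v <-] := fs w.
Qed.

Lemma fd_rV n : fd 'rV[k]_n.
Proof. by exists n, idfun. Qed.

(** Finitely many maps whose kernels intersect in zero are stacked into one row vector, by induction
    on the list. *)
Lemma fd_joint (I : eqType) (L : seq I) V (W : I -> lmodType k)
    (f : forall i, {linear V -> W i}) :
  (forall i, i \in L -> fd (W i)) ->
  (forall v, (forall i, i \in L -> f i v = 0) -> v = 0) -> fd V.
Proof.
move=> Wfd sep.
suff [n [g gP]] : exists n (g : {linear V -> 'rV[k]_n}),
    forall v, g v = 0 -> forall i, i \in L -> f i v = 0.
  by exists n, g; apply: linearN_inj => v /gP /sep.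
elim: {sep} L Wfd => [|i L IH] Wfd; first by exists 0, (\0 : {linear V -> 'rV[k]_0}).
have [|n [g gP]] := IH; first by move=> j jL; apply: Wfd; rewrite inE jL orbT.
have [m [h hi]] := Wfd i (mem_head _ _).
pose e v := row_mx (h (f i v)) (g v).
have elin : linear e.
  by move=> a x y; rewrite /e !linearP scale_row_mx add_row_mx.
exists _, (mklin elin) => v; rewrite /= /linear_of_fun /e -[0]hsubmxK !linear0.
move=> /eq_row_mx[h0 /gP g0] j; rewrite inE => /orP[/eqP ->|/g0 //].
by apply: hi; rewrite linear0.
Qed.

Lemma fd_ffun (I : finType) V : fd V -> fd {ffun I -> V}.
Proof.
move=> Vfd.
have evlin i : linear (fun c : {ffun I -> V} => c i) by move=> a x y; rewrite !ffunE.
apply: (@fd_joint _ (enum I) _ (fun=> V) (fun i => mklin (evlin i))) => // c c0.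
by apply/ffunP => i; rewrite ffunE; apply: c0; rewrite mem_enum.
Qed.

Lemma fd_span V n (e : 'I_n -> V) :
  (forall v, exists c : 'I_n -> k, v = \sum_i c i *: e i) -> fd V.
Proof.
move=> sp.
pose f (c : 'rV[k]_n) := \sum_i c ord0 i *: e i.
have flin : linear f.
  move=> a x y; rewrite /f scaler_sumr -big_split; apply: eq_bigr => i _ /=.
  by rewrite !mxE scalerDl scalerA.
apply: (@fd_surj _ _ (mklin flin)) (fd_rV n) => v.
have [c ->] := sp v; exists (\row_i c i); rewrite /= /linear_of_fun /f.
by apply: eq_bigr => i _; rewrite mxE.
Qed.

Lemma fd_spanned V : fd V -> exists n (e : 'I_n -> V),
  forall v, exists c : 'I_n -> k, v = \sum_i c i *: e i.
Proof.
move=> [n [f fi]]; have [r rP] := generalized_inverse f.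
exists n, (fun i => r (delta_mx ord0 i)); move=> v; exists (fun i => f v ord0 i).
have e : r (f v) = v by apply: fi.
rewrite -[LHS]e {1}(row_sum_delta (f v)) linear_sum.
by apply: eq_bigr => i _; rewrite linearZ.
Qed.

(** The matrix of a projection onto [U] has row space [U], and matrices have row bases. *)
Lemma subspace_row_base n (U : 'rV[k]_n -> Prop) : subspace U ->
  exists m (B : 'M[k]_(m, n)),
    [/\ row_free B, forall i, U (row i B) & forall v, U v -> (v <= B)%MS].
Proof.
move=> /exists_projection[p [pP pid]].
exists _, (row_base (lin1_mx p)); split=> [|i|v Uv].
- exact: row_base_free.
- have : (row i (row_base (lin1_mx p)) <= lin1_mx p)%MS.
    by apply: submx_trans (row_sub _ _) _; rewrite eq_row_base.
  by move=> /submxP[D ->]; rewrite mul_rV_lin1.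
- by rewrite eq_row_base; apply/submxP; exists v; rewrite mul_rV_lin1 pid.
Qed.

End FiniteDimension.

(** * Frobenius dimension *)

Section FrobeniusDimension.
Variable k : fieldType.

(** Pure tensors of two spanning families span; their coefficients form a matrix. *)
Lemma fd_tensor (U V : lmodType k) : fd U -> fd V -> fd (tensor U V).
Proof.
move=> /fd_spanned[n [e es]] /fd_spanned[m [e' e's]].
pose f (c : 'M[k]_(n, m)) := \sum_i \sum_j c i j *: pure (e i) (e' j).
have flin : linear f.
  move=> a x y; rewrite /f scaler_sumr -big_split; apply: eq_bigr => i _ /=.
  rewrite scaler_sumr -big_split; apply: eq_bigr => j _ /=.
  by rewrite !mxE scalerDl scalerA.
apply: (@fd_surj _ _ _ (mklin flin)); last first.
  apply: (@fd_inj _ _ _ (mxvec : {linear 'M[k]_(n, m) -> 'rV[k]_(n * m)})) (fd_rV _ _).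
  exact: can_inj mxvecK.
(* A tensor is the class of a list of pairs, which is handled pair by pair. *)
move=> t; rewrite -[t]reprK; elim: (repr t) => [|[u v] s [c cP]].
  by exists 0; rewrite linear0.
have [cu ->] := es u; have [cv ->] := e's v.
exists ((\matrix_(i, j) (cu i * cv j)) + c); rewrite linearD /= cP.
have -> : linear_of_fun flin (\matrix_(i, j) (cu i * cv j)) =
          pure (\sum_i cu i *: e i) (\sum_j cv j *: e' j).
  rewrite /linear_of_fun /f linear_sumlz; apply: eq_bigr => i _.
  rewrite linear_sumr; apply: eq_bigr => j _.
  by rewrite mxE linearZl_LR linearZr_LR /= scalerA.
apply: tensor_eq => W b.
by rewrite [LHS]tensor_eval_add tensor_eval_pure !tensor_evalE /pairing_sum big_cons.
Qed.

Variable A : algType k.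

Lemma lact_linear (a : A) : linear (lact a).
Proof.
pose f x y : tensor A A := pure (a * x) y.
have f_bilinear : bilinear_for *:%R *:%R f.
  split=> [v c u u'|u c v v']; rewrite /f; last by rewrite linearPr.
  by rewrite mulrDr -scalerAr linearPl.
pose F := bilinear_isBilinear.Build k A A (tensor A A) *:%R *:%R f f_bilinear.
pose g : {bilinear A -> A -> tensor A A} := HB.pack f F.
exact: (tensor_eval_linear g).
Qed.

Lemma ract_linear (a : A) : linear (fun t => ract t a).
Proof.
pose f x y : tensor A A := pure x (y * a).
have f_bilinear : bilinear_for *:%R *:%R f.
  split=> [v c u u'|u c v v']; rewrite /f; first by rewrite linearPl.
  by rewrite mulrDl -scalerAl linearPr.
pose F := bilinear_isBilinear.Build k A A (tensor A A) *:%R *:%R f f_bilinear.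
pose g : {bilinear A -> A -> tensor A A} := HB.pack f F.
exact: (tensor_eval_linear g).
Qed.

Lemma coproduct_linear a (D D' D'' : {linear A -> tensor A A}) :
  open_Frobenius_coproduct D -> open_Frobenius_coproduct D' ->
  D'' =1 (fun x => a *: D x + D' x) -> open_Frobenius_coproduct D''.
Proof.
move=> hD hD' e x y; have [l r] := hD x y; have [l' r'] := hD' x y.
by rewrite !e lact_linear (ract_linear y) -l -l' -r -r'.
Qed.

(** A coproduct is determined by its values on a spanning family of [A], so the coproducts embed as
    a subspace of a row space; a row basis lifts back to them. *)
Lemma fd_finite_Frobenius_dimension : fd A -> finite_Frobenius_dimension A.
Proof.
move=> Afd; have [m [phi phi_inj]] := fd_tensor Afd Afd.
have [n [e es]] := fd_spanned Afd.
pose ev (D : {linear A -> tensor A A}) := mxvec (\matrix_i phi (D (e i))).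
have ev_inj D D' : ev D = ev D' -> D =1 D'.
  move=> /(can_inj mxvecK)/row_matrixP eDD a; have [c ->] := es a.
  rewrite !linear_sum; apply: eq_bigr => i _; rewrite !linearZ; congr (_ *: _).
  by apply: phi_inj; have := eDD i; rewrite !rowK.
(* Sums of any length: length 0 serves for the zero map and length 2 for [a D + D']. *)
have ev_sum r (c : 'I_r -> k) (D : 'I_r -> {linear A -> tensor A A})
    (D' : {linear A -> tensor A A}) :
    D' =1 (fun a => \sum_i c i *: D i a) -> ev D' = \sum_i c i *: ev (D i).
  move=> eD; rewrite /ev; under eq_bigr do rewrite -linearZ.
  rewrite -linear_sum; congr mxvec; apply/matrixP => i j.
  rewrite summxE !mxE eD linear_sum summxE; apply: eq_bigr => l _.
  by rewrite linearZ !mxE.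
have [|q [B [Bfree BU Bmax]]] := @subspace_row_base k _
    (fun w => exists2 D, open_Frobenius_coproduct D & ev D = w).
  split=> [|a _ _ [D hD <-] [D' hD' <-]].
    exists (\0 : {linear A -> tensor A A}).
      move=> x y; split; first exact: esym (linear0 (mklin (lact_linear x))).
      exact: esym (linear0 (mklin (ract_linear y))).
    rewrite (@ev_sum 0 (fun=> 0) (fun=> \0)) ?big_ord0 // => x.
    by rewrite big_ord0.
  have comb_lin : linear (fun x => a *: D x + D' x).
    move=> b x y; rewrite (linearP D) (linearP D') !scalerDr !scalerA [a * b]mulrC.
    by rewrite addrACA.
  have hc : open_Frobenius_coproduct (mklin comb_lin)
    by apply: (@coproduct_linear a D D' _ hD hD') => x.
  exists (mklin comb_lin) => //.
  rewrite (@ev_sum 2 (fun i => if i == 0 then a else 1)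
            (fun i => if i == 0 then D else D')) => [|x].
    by rewrite big_ord_recl big_ord1 scale1r.
  by rewrite big_ord_recl big_ord1 scale1r.
have /boolp.choice[D DP] i : exists D : {linear A -> tensor A A},
    open_Frobenius_coproduct D /\ ev D = row i B.
  by have [D ? ?] := BU i; exists D.
have sum_lin (c : 'I_q -> k) : linear (fun a => \sum_i c i *: D i a).
  move=> a x y; rewrite scaler_sumr -big_split; apply: eq_bigr => i _ /=.
  by rewrite linearP scalerDr !scalerA mulrC.
have ev_comb (c : 'I_q -> k) : ev (mklin (sum_lin c)) = (\row_i c i) *m B.
  rewrite (@ev_sum _ c D) // mulmx_sum_row; apply: eq_bigr => i _.
  by rewrite mxE; case: (DP i) => _ ->.
exists q, D; split=> [i|c c0 i|D' hD'].
- by case: (DP i).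
- have : (\row_i c i) *m B = 0 *m B.
    rewrite mul0mx -ev_comb (@ev_sum 0 (fun=> 0) (fun=> \0)) ?big_ord0 // => a.
    by rewrite big_ord0 -[RHS](c0 a).
  by move=> /(row_free_inj Bfree)/rowP/(_ i); rewrite !mxE.
- have /submxP[c cP] : (ev D' <= B)%MS by apply: Bmax; exists D'.
  exists (fun i => c ord0 i); move=> a.
  have -> : D' a = mklin (sum_lin (fun i => c ord0 i)) a; last by [].
  apply: ev_inj; rewrite ev_comb cP; congr (_ *m _).
  by apply/rowP => i; rewrite mxE.
Qed.

End FrobeniusDimension.

(** * Path algebras and coinduced modules *)

(* Families indexed by the integers are built in the degrees [i + 1], where all
   differentials have the right types, and transported once and for all. *)
Definition reindex_fam (P : int -> Type) (f : forall i, P (i + 1)) i : P i :=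
  eq_rect _ P (f (i - 1)) _ (subrK 1 i).

Lemma reindex_famE (P : int -> Type) (f : forall i, P (i + 1)) i :
  reindex_fam f (i + 1) = f i.
Proof.
rewrite /reindex_fam; move: (subrK _ _) (addrK 1 i); move: (i + 1 - 1) => j e ij.
subst j.
by rewrite (eq_irrelevance e erefl).
Qed.

(** * Restriction of scalars to the ground field *)

Section RestrictionOfScalars.
Variables (k : fieldType) (H : algType k).

(** An alias of the carrier, so that the module structures over [H] and over [k] can coexist. *)
Definition resk (M : lmodType H) : Type := M.

Section Instances.
Variable M : lmodType H.
HB.instance Definition _ := GRing.Zmodule.on (resk M).
Definition resk_scale (a : k) (x : resk M) : resk M := a%:A *: (x : M).
Fact resk_scaleA a b x : resk_scale a (resk_scale b x) = resk_scale (a * b) x.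
Proof. by rewrite /resk_scale scalerA mulr_algl scalerA. Qed.
Fact resk_scale1 : left_id 1 resk_scale.
Proof. by move=> x; rewrite /resk_scale !scale1r. Qed.
Fact resk_scaleDr : right_distributive resk_scale +%R.
Proof. by move=> a x y; rewrite /resk_scale scalerDr. Qed.
Fact resk_scaleDl x : {morph resk_scale^~ x : a b / a + b}.
Proof. by move=> a b; rewrite /resk_scale !scalerDl. Qed.
HB.instance Definition _ := GRing.Zmodule_isLmodule.Build k (resk M)
  resk_scaleA resk_scale1 resk_scaleDr resk_scaleDl.
Lemma reskE a (x : M) : a *: (x : resk M) = a%:A *: x.
Proof. by []. Qed.
End Instances.

Lemma resk_linear (M N : lmodType H) (f : {linear M -> N}) :
  linear (f : resk M -> resk N).
Proof. by move=> a x y; rewrite !reskE linearP. Qed.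

Definition reskf (M N : lmodType H) (f : {linear M -> N}) :
  {linear resk M -> resk N} := mklin (resk_linear f).

Lemma fd_resk (M : lmodType H) n (e : 'I_n -> M) :
  (forall x, exists c : 'I_n -> H, x = \sum_i c i *: e i) -> fd H -> fd (resk M).
Proof.
move=> es Hfd.
pose f (c : {ffun 'I_n -> H}) : resk M := \sum_i c i *: e i.
have flin : linear f.
  move=> a x y; rewrite reskE /f scaler_sumr -big_split; apply: eq_bigr => i _ /=.
  by rewrite !ffunE scalerDl scalerA mulr_algl.
apply: (@fd_surj _ _ _ (mklin flin)) (fd_ffun _ Hfd) => x.
have [c ->] := es x; exists [ffun i => c i]; rewrite /= /linear_of_fun /f.
by apply: eq_bigr => i _; rewrite ffunE.
Qed.

Lemma resk_fg (M : lmodType H) : fd (resk M) ->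
  exists n (e : 'I_n -> M), forall x, exists c : 'I_n -> H, x = \sum_i c i *: e i.
Proof.
move=> /fd_spanned[n [e es]]; exists n, e; move=> x; have [c ->] := es x.
by exists (fun i => (c i)%:A).
Qed.

Definition fgmod_of (M : lmodType H) (Mfd : fd (resk M)) : fgmod H :=
  Fgmod (resk_fg Mfd).

Lemma fgmod_fd (M : fgmod H) : fd H -> fd (resk M).
Proof. by move=> Hfd; have [n [e es]] := fgcarP M; apply: fd_resk es Hfd. Qed.

End RestrictionOfScalars.

Section PathAlgebraTheory.
Variables (k : fieldType) (Q : quiver) (H : algType k).
Variable b : vertex Q * seq (arrow Q) -> H.

Definition idem v : H := b (v, [::]).
Definition arr a : H := b (src a, [:: a]).

Hypothesis bP : is_path_algebra b.

Lemma idem_mul_path v p : is_path p -> idem v * b p = if v == p.1 then b p else 0.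
Proof.
by case: p => w s ps; rewrite (path_mul bP) //= /path_end /=; case: eqP => // ->.
Qed.

Lemma idem_mul u v : idem u * idem v = if u == v then idem u else 0.
Proof. by rewrite idem_mul_path //=; case: eqP => // ->. Qed.

Lemma arr_mul_path a p : is_path p ->
  arr a * b p = if tgt a == p.1 then b (src a, a :: p.2) else 0.
Proof. by case: p => w s ps; rewrite (path_mul bP) // /is_path /= eqxx. Qed.

Lemma arr_mul_idem a v : arr a * idem v = if tgt a == v then arr a else 0.
Proof. by rewrite arr_mul_path. Qed.

Lemma idem_mul_arr v a : idem v * arr a = if v == src a then arr a else 0.
Proof. by rewrite idem_mul_path // /is_path /= eqxx. Qed.

Lemma path_cons a s : walk (tgt a) s -> b (src a, a :: s) = arr a * b (tgt a, s).
Proof. by move=> ws; rewrite arr_mul_path // eqxx. Qed.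

Lemma idem_sum : \sum_v idem v = 1.
Proof. by rewrite (path_one bP). Qed.

Lemma path_algebra_ind (P : H -> Prop) : P 0 ->
  (forall a x y, P x -> P y -> P (a *: x + y)) -> (forall p, is_path p -> P (b p)) ->
  forall h, P h.
Proof.
move=> P0 Plin Pb h; have [S [c [/allP allS ->]]] := path_span bP h.
elim: S allS => [|p S IH] allS; first by rewrite big_nil.
rewrite big_cons; apply: Plin; first by apply/Pb/allS/mem_head.
by apply: IH => q qS; apply: allS; rewrite inE qS orbT.
Qed.

(** A nontrivial path is its first arrow times the rest, so closure under left multiplication by
    arrows takes care of all paths. *)
Lemma path_algebra_gen_ind (P : H -> Prop) : P 0 ->
  (forall a x y, P x -> P y -> P (a *: x + y)) -> (forall v, P (idem v)) ->
  (forall a x, P x -> P (arr a * x)) -> forall h, P h.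
Proof.
move=> P0 Plin Pe Px; apply: path_algebra_ind => // -[v s].
elim: s v => [|a s IH] v; first by move=> _; apply: Pe.
by rewrite /is_path /= => /andP[/eqP <- ws]; rewrite path_cons //; apply/Px/IH.
Qed.

Variable L : seq (vertex Q * seq (arrow Q)).
Hypothesis LP : forall p, is_path p -> p \in L.

Let L' := undup [seq p <- L | is_path p].

Let L'P p : (p \in L') = is_path p.
Proof. by rewrite mem_undup mem_filter; apply: andb_idr => /LP. Qed.

Let sum_delta (M : lmodType k) (g : vertex Q * seq (arrow Q) -> M) p : is_path p ->
  \sum_(q <- L') (q == p)%:R *: g q = g p.
Proof.
move=> pp; rewrite (bigD1_seq p) ?L'P ?undup_uniq //= eqxx scale1r.
by rewrite big1 ?addr0 // => q /negPf ->; rewrite scale0r.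
Qed.

Let sum_lin (M : lmodType k) (g : vertex Q * seq (arrow Q) -> M) a c c' :
  \sum_(q <- L') (a * c q + c' q) *: g q =
  a *: (\sum_(q <- L') c q *: g q) + \sum_(q <- L') c' q *: g q.
Proof.
rewrite scaler_sumr -big_split; apply: eq_bigr => q _ /=.
by rewrite scalerDl scalerA.
Qed.

Lemma path_algebra_fd : fd H.
Proof.
have tot h : exists c, h = \sum_(q <- L') c q *: b q.
  elim/path_algebra_ind: h => [|a _ _ [c ->] [c' ->]|p pp].
  - by exists (fun=> 0); rewrite big1 // => q _; rewrite scale0r.
  - by exists (fun q => a * c q + c' q); rewrite sum_lin.
  - by exists (fun q => (q == p)%:R); rewrite sum_delta.
pose f (c : {ffun 'I_(size L') -> k}) : H := \sum_i c i *: b (tnth (in_tuple L') i).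
apply: (@fd_span _ _ (size L') (fun i => b (tnth (in_tuple L') i))) => h.
have [c ->] := tot h; exists (fun i => c (tnth (in_tuple L') i)).
by rewrite big_tnth.
Qed.

(** Relate [h] and [m] when they have a common coefficient family on the paths; a linear selection
    has the right values because the paths are free. *)
Lemma path_algebra_extend (M : lmodType k) (g : vertex Q * seq (arrow Q) -> M) :
  exists f : {linear H -> M}, forall p, is_path p -> f (b p) = g p.
Proof.
have [h||f fP] := @linear_selection k H M (fun h m => exists2 c,
  h = \sum_(q <- L') c q *: b q & m = \sum_(q <- L') c q *: g q).
- elim/path_algebra_ind: h => [|a _ _ [_ [c -> _]] [_ [c' -> _]]|p pp].
  + exists 0, (fun=> 0); by rewrite big1 // => q _; rewrite scale0r.
  + eexists; exists (fun q => a * c q + c' q); last by reflexivity.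
    by rewrite sum_lin.
  + by eexists; exists (fun q => (q == p)%:R); [rewrite sum_delta|reflexivity].
- move=> a v v' w w' [c -> ->] [c' -> ->].
  by exists (fun q => a * c q + c' q); rewrite sum_lin.
exists f => p pp; have [c e ->] := fP (b p).
rewrite -[RHS](sum_delta g pp); apply: eq_big_seq => q qL.
congr (_ *: _); apply/eqP; rewrite -subr_eq0; apply/eqP.
apply: (path_free bP (S := L') (c := fun q => c q - (q == p)%:R)) => //.
- exact: undup_uniq.
- by apply/allP => r; rewrite L'P.
under eq_bigr do rewrite scalerBl.
by rewrite sumrB -e sum_delta // subrr.
Qed.

End PathAlgebraTheory.

(** * Coinduced modules and the differential between them *)

Section Coinduction.
Variables (k : fieldType) (Q : quiver) (H : algType k).
Variable b : vertex Q * seq (arrow Q) -> H.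

Local Notation e := (idem b).
Local Notation x_ := (arr b).

Section CoinductionModule.
Variables M N : lmodType H.

(* [cph] is an element of [Hom_E(H, M)], with [E] the span of the idempotents, and
   [cps] one of the product over the arrows [c] of the [Hom_k(e_(tgt c) H, e_(src c) N)],
   extended by zero to [H]; [H] acts by right translations of the argument. *)
Record coind := Coind {
  cph : H -> M;
  cps : arrow Q -> H -> N;
  cph_lin : forall a x y, cph (a *: x + y) = a%:A *: cph x + cph y;
  cph_idem : forall v x, cph (e v * x) = e v *: cph x;
  cps_lin : forall c a x y, cps c (a *: x + y) = a%:A *: cps c x + cps c y;
  cps_src : forall c x, e (src c) *: cps c x = cps c x;
  cps_tgt : forall c x, cps c (e (tgt c) * x) = cps c x }.

Lemma coind_eq (f g : coind) : cph f =1 cph g -> cps f =2 cps g -> f = g.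
Proof.
case: f g => [f f' p1 p2 p3 p4 p5] [g g' q1 q2 q3 q4 q5] /= /funext ef eg.
have {}eg : f' = g' by apply/funext => c; apply/funext => x.
by subst g g'; congr Coind; apply: Prop_irrelevance.
Qed.

HB.instance Definition _ := gen_eqMixin coind.
HB.instance Definition _ := gen_choiceMixin coind.

Program Definition coind0 := @Coind (fun=> 0) (fun=> fun=> 0) _ _ _ _ _.
Solve Obligations with by move=> *; rewrite ?scaler0 ?addr0.

Program Definition coind_add (f g : coind) :=
  @Coind (fun x => cph f x + cph g x) (fun c x => cps f c x + cps g c x) _ _ _ _ _.
Next Obligation. by rewrite !cph_lin scalerDr addrACA. Qed.
Next Obligation. by rewrite !cph_idem scalerDr. Qed.
Next Obligation. by rewrite !cps_lin scalerDr addrACA. Qed.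
Next Obligation. by rewrite scalerDr !cps_src. Qed.
Next Obligation. by rewrite !cps_tgt. Qed.

Program Definition coind_opp (f : coind) :=
  @Coind (fun x => - cph f x) (fun c x => - cps f c x) _ _ _ _ _.
Next Obligation. by rewrite !cph_lin opprD scalerN. Qed.
Next Obligation. by rewrite !cph_idem scalerN. Qed.
Next Obligation. by rewrite !cps_lin opprD scalerN. Qed.
Next Obligation. by rewrite scalerN !cps_src. Qed.
Next Obligation. by rewrite !cps_tgt. Qed.

Program Definition coind_scale (h : H) (f : coind) :=
  @Coind (fun x => cph f (x * h)) (fun c x => cps f c (x * h)) _ _ _ _ _.
Next Obligation. by rewrite mulrDl -scalerAl cph_lin. Qed.
Next Obligation. by rewrite -mulrA cph_idem. Qed.
Next Obligation. by rewrite mulrDl -scalerAl cps_lin. Qed.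
Next Obligation. by rewrite cps_src. Qed.
Next Obligation. by rewrite -mulrA cps_tgt. Qed.

Fact coind_addA : associative coind_add.
Proof. by move=> f g h; apply: coind_eq => [x|c x] /=; rewrite addrA. Qed.
Fact coind_addC : commutative coind_add.
Proof. by move=> f g; apply: coind_eq => [x|c x] /=; rewrite addrC. Qed.
Fact coind_add0 : left_id coind0 coind_add.
Proof. by move=> f; apply: coind_eq => [x|c x] /=; rewrite add0r. Qed.
Fact coind_addN : left_inverse coind0 coind_opp coind_add.
Proof. by move=> f; apply: coind_eq => [x|c x] /=; rewrite addNr. Qed.
HB.instance Definition _ :=
  GRing.isZmodule.Build coind coind_addA coind_addC coind_add0 coind_addN.

Lemma cphD (f : coind) x y : cph f (x + y) = cph f x + cph f y.
Proof. by rewrite -[x]scale1r cph_lin !scale1r. Qed.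
Lemma cpsD (f : coind) c x y : cps f c (x + y) = cps f c x + cps f c y.
Proof. by rewrite -[x]scale1r cps_lin !scale1r. Qed.

Fact coind_scaleA a a' f : coind_scale a (coind_scale a' f) = coind_scale (a * a') f.
Proof. by apply: coind_eq => [x|c x] /=; rewrite mulrA. Qed.
Fact coind_scale1 : left_id 1 coind_scale.
Proof. by move=> f; apply: coind_eq => [x|c x] /=; rewrite mulr1. Qed.
Fact coind_scaleDr : right_distributive coind_scale +%R.
Proof. by move=> a f g; apply: coind_eq. Qed.
Fact coind_scaleDl f : {morph coind_scale^~ f : a a' / a + a'}.
Proof.
by move=> a a'; apply: coind_eq => [x|c x] /=; rewrite mulrDr ?cphD ?cpsD.
Qed.
HB.instance Definition _ := GRing.Zmodule_isLmodule.Build H coind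
  coind_scaleA coind_scale1 coind_scaleDr coind_scaleDl.

Lemma cph0 (f : coind) : cph f 0 = 0.
Proof. by apply: (addrI (cph f 0)); rewrite -cphD !addr0. Qed.
Lemma cps0 (f : coind) c : cps f c 0 = 0.
Proof. by apply: (addrI (cps f c 0)); rewrite -cpsD !addr0. Qed.
Lemma cphZ (f : coind) a x : cph f (a *: x) = a%:A *: cph f x.
Proof. by rewrite -[_ *: x]addr0 cph_lin cph0 addr0. Qed.
Lemma cpsZ (f : coind) c a x : cps f c (a *: x) = a%:A *: cps f c x.
Proof. by rewrite -[_ *: x]addr0 cps_lin cps0 addr0. Qed.

Lemma coindDph (f g : coind) x : cph (f + g) x = cph f x + cph g x. Proof. by []. Qed.
Lemma coindDps (f g : coind) c x : cps (f + g) c x = cps f c x + cps g c x.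
Proof. by []. Qed.
Lemma coindZph h (f : coind) x : cph (h *: f) x = cph f (x * h). Proof. by []. Qed.
Lemma coindZps h (f : coind) c x : cps (h *: f) c x = cps f c (x * h).
Proof. by []. Qed.
Lemma coind0ph x : cph 0 x = 0. Proof. by []. Qed.
Lemma coind0ps c x : cps 0 c x = 0. Proof. by []. Qed.

Definition coindE := (coindDph, coindDps, coindZph, coindZps, coind0ph, coind0ps).

End CoinductionModule.
End Coinduction.

Section CoinductionTheory.
Variables (k : fieldType) (Q : quiver) (H : algType k).
Variable b : vertex Q * seq (arrow Q) -> H.
Hypothesis bP : is_path_algebra b.
Variable L : seq (vertex Q * seq (arrow Q)).
Hypothesis LP : forall p, is_path p -> p \in L.

Local Notation e := (idem b).
Local Notation x_ := (arr b).

Lemma scaler_algA (M : lmodType H) a x (y : M) : (a *: x) *: y = a%:A *: (x *: y).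
Proof. by rewrite scalerA mulr_algl. Qed.

(** Both components are determined by their values on a finite spanning family of [H], and there are
    finitely many arrows. *)
Lemma fd_coind (M N : lmodType H) :
  fd (resk M) -> fd (resk N) -> fd (resk (coind b M N)).
Proof.
move=> Mfd Nfd; have [n [c cs]] := fd_spanned (path_algebra_fd bP LP).
pose f1 (f : resk (coind b M N)) : {ffun 'I_n -> resk M} := [ffun i => cph f (c i)].
have f1lin : linear f1.
  move=> a x y; apply/ffunP => i; rewrite !ffunE !reskE -cphZ.
  by rewrite [LHS](coindDph _ _ _) (coindZph _ _ _) mulr_algr.
pose f2 (f : resk (coind b M N)) : {ffun arrow Q * 'I_n -> resk N} :=
  [ffun p => cps f p.1 (c p.2)].
have f2lin : linear f2.
  move=> a x y; apply/ffunP => i; rewrite !ffunE !reskE -cpsZ.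
  by rewrite [LHS](coindDps _ _ _) (coindZps _ _ _) mulr_algr.
pose W i : lmodType k :=
  if i then ({ffun 'I_n -> resk M} : lmodType k)
  else ({ffun arrow Q * 'I_n -> resk N} : lmodType k).
pose g i : {linear resk (coind b M N) -> W i} :=
  if i as i return {linear resk (coind b M N) -> W i} then mklin f1lin else mklin f2lin.
apply: (@fd_joint _ _ [:: true; false] _ W g) => [[] _|f f0]; [exact: fd_ffun..|].
have /ffunP h1 := f0 true erefl; have /ffunP h2 := f0 false erefl.
apply: coind_eq => [h|a h]; have [d ->] := cs h.
  apply: (big_ind (fun z => cph f z = 0)) => [|x y hx hy|i _]; first exact: cph0.
    by rewrite cphD hx hy addr0.
  have := h1 i; rewrite /= /linear_of_fun !ffunE => h0.
  by rewrite cphZ h0 scaler0.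
apply: (big_ind (fun z => cps f a z = 0)) => [|x y hx hy|i _]; first exact: cps0.
  by rewrite cpsD hx hy addr0.
have := h2 (a, i); rewrite /= /linear_of_fun !ffunE => h0.
by rewrite cpsZ h0 scaler0.
Qed.

Section IntoCoind.
Variables V M N : lmodType H.

Definition idem_compat (u : resk V -> resk M) :=
  forall v y, u (e v *: (y : V)) = e v *: (u y : M).
Definition arr_compat (w : arrow Q -> resk V -> resk N) :=
  (forall c y, e (src c) *: (w c y : N) = w c y) /\
  (forall c y, w c (e (tgt c) *: (y : V)) = w c y).

Variables (u : {linear resk V -> resk M}) (w : arrow Q -> {linear resk V -> resk N}).
Hypothesis (uP : idem_compat u) (wP : arr_compat w).

(** One direction of the adjunction: a pair of [E]-linear data [(u, w)] on [V] induces an [H]-linear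
    map into the coinduced module. *)
Program Definition to_coind_fun (y : V) : coind b M N :=
  @Coind _ _ _ _ _ _ (fun h => u (h *: y)) (fun c h => w c (h *: y)) _ _ _ _ _.
Next Obligation.
by rewrite scalerDl (scaler_algA a x y); exact: (linearP u a (x *: y) (y0 *: y)).
Qed.
Next Obligation. by rewrite -scalerA uP. Qed.
Next Obligation.
by rewrite scalerDl (scaler_algA a x y); exact: (linearP (w c) a (x *: y) (y0 *: y)).
Qed.
Next Obligation. by case: wP => ->. Qed.
Next Obligation. by case: wP => _ h; rewrite -scalerA h. Qed.

Lemma to_coind_linear : linear to_coind_fun.
Proof.
move=> h y z; apply: coind_eq => [x|c x] /=; rewrite scalerDr scalerA.
  exact: (linearD u).
exact: (linearD (w c)).
Qed.
Definition to_coind : {linear V -> coind b M N} := mklin to_coind_linear.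
Lemma to_coindE1 y h : cph (to_coind y) h = u (h *: y). Proof. by []. Qed.
Lemma to_coindE2 y c h : cps (to_coind y) c h = w c (h *: y). Proof. by []. Qed.
End IntoCoind.

Section FromCoind.
Variables (V M N : lmodType H) (f : {linear V -> coind b M N}).

(** The other direction of the adjunction is evaluation at 1. *)
Lemma coind_phi_linear : linear (fun y : resk V => cph (f y) 1 : resk M).
Proof. by move=> a y z; rewrite !reskE linearP !coindE mul1r -cphZ. Qed.
Definition coind_phi : {linear resk V -> resk M} := mklin coind_phi_linear.

Lemma coind_psi_linear c : linear (fun y : resk V => cps (f y) c 1 : resk N).
Proof. by move=> a y z; rewrite !reskE linearP !coindE mul1r -cpsZ. Qed.
Definition coind_psi c : {linear resk V -> resk N} := mklin (coind_psi_linear c).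

Lemma coind_phiE (y : V) (h : H) : coind_phi (h *: y) = cph (f y) h.
Proof. by rewrite /= /linear_of_fun linearZ /= mul1r. Qed.
Lemma coind_psiE c (y : V) (h : H) : coind_psi c (h *: y) = cps (f y) c h.
Proof. by rewrite /= /linear_of_fun linearZ /= mul1r. Qed.

Lemma coind_phi_compat : idem_compat coind_phi.
Proof. by move=> v y; rewrite coind_phiE -[e v]mulr1 cph_idem mulr1. Qed.
Lemma coind_psi_compat : arr_compat coind_psi.
Proof.
split=> c y; first by rewrite /= /linear_of_fun cps_src.
by rewrite coind_psiE -[e _]mulr1 cps_tgt.
Qed.
End FromCoind.

Section CoindDifferential.
Variables (N M M' : lmodType H) (dN : {linear N -> M}) (dM : {linear M -> M'}).

(** The second map of the coresolution: it measures the failure of [f] to commute with the arrow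
    [c]. *)
Definition coind_delta (f : H -> M) c h := f (x_ c * h) - x_ c *: f h.

(** The differential of the total complex; the sign of [dM] makes the two mixed terms of its square
    cancel. *)
Program Definition coind_diff_fun (f : coind b M N) : coind b M' M :=
  @Coind _ _ _ _ _ _ (fun h => - dM (cph f h))
    (fun c h => coind_delta (cph f) c h + dN (cps f c h)) _ _ _ _ _.
Next Obligation. by rewrite cph_lin linearP opprD scalerN. Qed.
Next Obligation. by rewrite cph_idem linearZ /= scalerN. Qed.
Next Obligation.
rewrite /coind_delta mulrDr -scalerAr !cph_lin cps_lin linearP !scalerDr opprD.
have -> : x_ c *: (a%:A *: cph f x) = a%:A *: (x_ c *: cph f x).
  by rewrite !scalerA mulr_algl mulr_algr.
by rewrite scalerN (addrACA (a%:A *: _)) (addrACA (_ - _)).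
Qed.
Next Obligation.
rewrite /coind_delta scalerDr scalerBr -cph_idem mulrA scalerA.
by rewrite !(idem_mul_arr bP) eqxx -linearZ /= cps_src.
Qed.
Next Obligation.
rewrite /coind_delta mulrA !(arr_mul_idem bP) eqxx cps_tgt cph_idem scalerA.
by rewrite (arr_mul_idem bP) eqxx.
Qed.

Lemma coind_diff_linear : linear coind_diff_fun.
Proof.
move=> h f g; apply: coind_eq => [x|c x] /=.
  by rewrite linearD opprD.
rewrite /coind_delta linearD /= scalerDr opprD -mulrA.
by rewrite (addrACA (cph f _)) (addrACA (_ - _)).
Qed.
Definition coind_diff : {linear coind b M N -> coind b M' M} := mklin coind_diff_linear.

Lemma coind_diffE1 f h : cph (coind_diff f) h = - dM (cph f h). Proof. by []. Qed.
Lemma coind_diffE2 f c h :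
  cps (coind_diff f) c h = cph f (x_ c * h) - x_ c *: cph f h + dN (cps f c h).
Proof. by []. Qed.

End CoindDifferential.

(** Exactness at the right end: the equation is solved by recursion on paths, with value 0 on the
    trivial ones, and extended linearly. *)
Lemma coind_delta_surj (M M' N : lmodType H) (g : coind b M' M) :
  exists f : coind b M N, (forall c h, cps f c h = 0) /\
    forall c h, cph f (x_ c * h) - x_ c *: cph f h = cps g c h.
Proof.
pose G := fix G s : resk M := if s is c :: s' then
  (cps g c (b (tgt c, s')) : M) + x_ c *: (G s' : M) else 0.
(* The value at a path starting at [w] lies in [e w] times [M], which makes the extension
   [E]-linear. *)
have Ge v w s : walk w s -> e v *: (G s : M) = if v == w then G s else 0.
  case: s => [|c s] /=; first by rewrite scaler0 if_same.
  move=> /andP[/eqP <- ws]; rewrite scalerDr scalerA (idem_mul_arr bP).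
  rewrite -cps_src scalerA (idem_mul bP).
  by case: eqP => [->|_]; rewrite ?cps_src // !scale0r addr0.
have [f fP] := path_algebra_extend bP LP (fun p => G p.2).
have fe v x : f (e v * x) = e v *: (f x : M).
  elim/(path_algebra_ind bP): x => [|a x y hx hy|[w s] ws].
  - by rewrite mulr0 !linear0 scaler0.
  - rewrite mulrDr -scalerAr !linearP hx hy !reskE scalerDr !scalerA.
    by rewrite mulr_algl mulr_algr.
  - rewrite (idem_mul_path bP) // fP //= (Ge _ w) //.
    by case: eqP => _; rewrite ?linear0 // fP.
have flin a x y : f (a *: x + y) = a%:A *: (f x : M) + f y by rewrite linearP.
exists (@Coind _ _ _ _ _ _ f (fun _ _ => 0) flin fe
  (fun=> fun a _ _ => esym (etrans (addr0 _) (scaler0 _ a%:A)))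
  (fun c _ => scaler0 _ _) (fun=> fun=> erefl)); split=> //= c x.
elim/(path_algebra_ind bP): x => [|a x y hx hy|[w s] ws].
- by rewrite mulr0 linear0 scaler0 subrr cps0.
- rewrite mulrDr -scalerAr !flin cps_lin -hx -hy.
  have -> : x_ c *: (a%:A *: (f x : M) + f y) =
      a%:A *: (x_ c *: (f x : M)) + x_ c *: (f y : M).
    by rewrite scalerDr !scalerA mulr_algl mulr_algr.
  by rewrite scalerBr opprD addrACA.
rewrite (arr_mul_path bP) //= [f (b (w, s))]fP //=.
case: (eqVneq (tgt c) w) ws => [<-|ne] ws.
  by rewrite fP /= ?addrK // /is_path /= eqxx.
(* If the path does not start at [tgt c], its product with [x_ c] is 0, [cps g c] vanishes on it,
   and [x_ c] kills [G s]. *)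
rewrite linear0 -[cps g c _]cps_tgt (idem_mul_path bP) //= (negPf ne) cps0.
have -> : x_ c = x_ c * e (tgt c) by rewrite (arr_mul_idem bP) eqxx.
by rewrite -scalerA (Ge _ w) // (negPf ne) scaler0 subrr.
Qed.

(** Exactness in the middle: a map that commutes with idempotents and arrows is [H]-linear. *)
Lemma coind_delta_eq0 (M N : lmodType H) (f : coind b M N) :
  (forall c h, cph f (x_ c * h) - x_ c *: cph f h = 0) ->
  forall h, cph f h = h *: cph f 1.
Proof.
move=> f0; apply: (path_algebra_gen_ind bP) => [|a x y hx hy|v|c x hx].
- by rewrite cph0 scale0r.
- by rewrite cph_lin hx hy scalerDl !scalerA mulr_algl.
- by rewrite -[e v in LHS]mulr1 cph_idem.
- by have /eqP := f0 c x; rewrite subr_eq0 => /eqP ->; rewrite hx scalerA.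
Qed.

End CoinductionTheory.

(** * Homotopies and the derived category *)

Section Composition.
Variables (k : fieldType) (ob : Type) (C : lincat k ob).

Lemma compDr X Y Z (g : hom C Y Z) (f f' : hom C X Y) :
  g \oc (f + f') = g \oc f + g \oc f'.
Proof. exact: linearDr. Qed.
Lemma compDl X Y Z (g g' : hom C Y Z) (f : hom C X Y) :
  (g + g') \oc f = g \oc f + g' \oc f.
Proof. exact: linearDl. Qed.
Lemma compZr X Y Z a (g : hom C Y Z) (f : hom C X Y) :
  g \oc (a *: f) = a *: (g \oc f).
Proof. exact: linearZr_LR. Qed.
Lemma compZl X Y Z a (g : hom C Y Z) (f : hom C X Y) :
  (a *: g) \oc f = a *: (g \oc f).
Proof. exact: linearZl_LR. Qed.
Lemma comp0r X Y Z (g : hom C Y Z) : g \oc 0 = 0 :> hom C X Z.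
Proof. exact: linear0r. Qed.
Lemma comp0l X Y Z (f : hom C X Y) : 0 \oc f = 0 :> hom C X Z.
Proof. exact: linear0l. Qed.

End Composition.

Section ChainMaps.
Variables (k : fieldType) (H : algType k).

Lemma fd_prod (V W : lmodType k) : fd V -> fd W -> fd (V * W)%type.
Proof.
move=> Vfd Wfd.
pose U i : lmodType k := if i then V else W.
pose g i : {linear (V * W)%type -> U i} :=
  if i as i return {linear (V * W)%type -> U i} then fst : {linear (V * W)%type -> V}
  else snd : {linear (V * W)%type -> W}.
apply: (@fd_joint _ _ [:: true; false] _ U g) => [[]//|[v w] h].
by have := h true erefl; have := h false erefl => /= -> ->.
Qed.

Lemma fd_resk_prod (M N : lmodType H) :
  fd (resk M) -> fd (resk N) -> fd (resk (M * N)%type).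
Proof.
move=> Mfd Nfd.
have idlin : linear (fun x : resk (M * N)%type => x : (resk M * resk N)%type) by [].
by apply: (@fd_inj _ _ _ (mklin idlin)) (fd_prod Mfd Nfd).
Qed.

Hypothesis Hfd : fd H.

Definition fgprod (M N : fgmod H) : fgmod H :=
  fgmod_of (fd_resk_prod (fgmod_fd M Hfd) (fgmod_fd N Hfd)).

Definition mkchain (X Y : cplx H) (f : forall i, X i -> Y i) (flin : forall i, linear (f i))
  (fP : forall i x, cdiff Y i (f i x) = f (i + 1) (cdiff X i x)) : chain_map X Y :=
  @ChainMap _ _ X Y (fun i => mklin (flin i)) fP.

Definition strict_le (X : cplx H) (a : int) := forall i, (a < i)%R -> forall x : X i, x = 0.
Definition strict_ge (X : cplx H) (a : int) := forall i, (i < a)%R -> forall x : X i, x = 0.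

Lemma cplx_strict (X : cplx H) : exists N : nat, strict_le X N /\ strict_ge X (- (N : int)).
Proof. by have [N hN] := cbounded X; exists N; split=> i hi; apply: hN; lia. Qed.

Section Cylinder.
Variable X : cplx H.

(** The cylinder of [X]: a chain map out of it amounts to two chain maps and a homotopy between
    them. *)
Definition cyl_diff_fun i (x : fgprod (fgprod (X i) (X i)) (X (i + 1))) :
    fgprod (fgprod (X (i + 1)) (X (i + 1))) (X (i + 1 + 1)) :=
  ((cdiff X i x.1.1 - x.2, cdiff X i x.1.2 + x.2), - cdiff X (i + 1) x.2).

Lemma cyl_diff_linear i : linear (@cyl_diff_fun i).
Proof.
move=> a x y; rewrite /cyl_diff_fun /= !linearP /=; congr ((_, _), _).
- rewrite -[RHS]/(a *: (cdiff X i x.1.1 - x.2) + (cdiff X i y.1.1 - y.2)).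
  by rewrite scalerDr addrACA.
- rewrite -[RHS]/(a *: (cdiff X i x.1.2 + x.2) + (cdiff X i y.1.2 + y.2)).
  by rewrite scalerDr addrACA.
Qed.

Program Definition cyl : cplx H :=
  @Cplx _ _ (fun i => fgprod (fgprod (X i) (X i)) (X (i + 1)))
    (fun i => mklin (@cyl_diff_linear i)) _ _.
Next Obligation.
rewrite /linear_of_fun /cyl_diff_fun /=.
rewrite (linearB (cdiff X (i + 1))) (linearD (cdiff X (i + 1))) !cdiffK.
by rewrite (linearN (cdiff X (i + 1 + 1))) cdiffK sub0r add0r !subrr !oppr0.
Qed.
Next Obligation.
have [N hN] := cbounded X; exists N.+1 => i hi [[x y] z].
by rewrite (hN i _ x) ?(hN i _ y) ?(hN _ _ z) //; lia.
Qed.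

Program Definition cyl0 : chain_map X cyl :=
  @mkchain X cyl (fun i x => ((x, 0), 0)) _ _.
Next Obligation. by move=> a x y; congr ((_, _), _) => /=; rewrite scaler0 addr0. Qed.
Next Obligation.
by rewrite /= /linear_of_fun /cyl_diff_fun /= !linear0 !addr0.
Qed.

Program Definition cyl1 : chain_map X cyl :=
  @mkchain X cyl (fun i x => ((0, x), 0)) _ _.
Next Obligation. by move=> a x y; congr ((_, _), _) => /=; rewrite scaler0 addr0. Qed.
Next Obligation.
by rewrite /= /linear_of_fun /cyl_diff_fun /= !linear0 !addr0.
Qed.

Program Definition cylp : chain_map cyl X :=
  @mkchain cyl X (fun i x => x.1.1 + x.1.2) _ _.
Next Obligation. by move=> a x y /=; rewrite scalerDr addrACA. Qed.
Next Obligation.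
by rewrite /= /linear_of_fun /cyl_diff_fun /= linearD addrACA addNr addr0.
Qed.

Lemma cylp_quasi_iso : quasi_iso cylp.
Proof.
move=> i; split.
  move=> [[x0 x1] y] /= [/eqP + + _] [w]; rewrite /linear_of_fun /= => _.
  move=> /eqP; rewrite addr_eq0 => /eqP dx1 e.
  (* The cocycle condition on the second coordinate says [d x1 = - y]. *)
  exists ((w, 0), x1); rewrite /linear_of_fun /cyl_diff_fun /=.
  by rewrite e addrK linear0 add0r dx1 opprK.
move=> y dy; exists ((y, 0), 0).
  by rewrite /= /linear_of_fun /cyl_diff_fun /= dy !linear0 !addr0.
by exists 0; rewrite linear0 /= /linear_of_fun /= addr0 subrr.
Qed.

End Cylinder.

(** The condition is imposed in the degrees [i + 1], where all types match without transport. *)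
Definition homotopic (X Y : cplx H) (f g : chain_map X Y) :=
  exists h : forall i, {linear X (i + 1) -> Y i},
    forall i x, g (i + 1) x - f (i + 1) x =
      cdiff Y i (h i x) + h (i + 1) (cdiff X (i + 1) x).

Section Localization.
Variable D : derived_category H.

Lemma dloc_id X : dloc D (chain_id X) = id1 D X.
Proof. by have [[h _] _ _] := dlocP D; apply: h. Qed.

Lemma dloc_comp X Y Z (g : chain_map Y Z) (f : chain_map X Y) :
  dloc D (chain_comp g f) = dloc D g \oc dloc D f.
Proof. by have [[_ h] _ _] := dlocP D; apply: h. Qed.

Lemma dloc_iso X Y (s : chain_map X Y) : quasi_iso s -> exists t : hom D Y X,
  t \oc dloc D s = id1 D X /\ dloc D s \oc t = id1 D Y.
Proof. by have [_ h _] := dlocP D; apply: h. Qed.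

Lemma dloc_ext X Y (f g : chain_map X Y) : (forall i, f i =1 g i) -> dloc D f = dloc D g.
Proof. by move=> /chain_map_eq ->. Qed.

Lemma dloc0 X Y (f : chain_map X Y) : (forall i x, f i x = 0) -> dloc D f = 0.
Proof.
move=> f0; have e : dloc D f = 1 *: dloc D f + dloc D f.
  by apply: dloc_linear => i x; rewrite !f0 scaler0 addr0.
by apply: (addrI (dloc D f)); rewrite addr0 [RHS]e scale1r.
Qed.

(** Both inclusions of [X] into its cylinder are sections of the quasi-isomorphism [cylp], hence
    become equal, and the homotopy factors [f] and [g] through them. *)
Lemma homotopic_dloc X Y (f g : chain_map X Y) : homotopic f g -> dloc D f = dloc D g.
Proof.
move=> [h hP].
pose F i (x : cyl X i) := f i x.1.1 + g i x.1.2 + h i x.2.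
have Flin i : linear (@F i).
  move=> a x y; rewrite /F /= !linearP /= !scalerDr.
  by rewrite (addrACA (a *: f i _)); apply: addrACA.
have FP i x : cdiff Y i (F i x) = F (i + 1) (cdiff (cyl X) i x).
  rewrite /F /= /linear_of_fun /cyl_diff_fun /=.
  rewrite !(linearD (cdiff Y i)) (linearB (f (i + 1))) (linearD (g (i + 1))).
  rewrite (linearN (h (i + 1))) !cmapP -!addrA; congr (_ + _).
  rewrite [RHS]addrCA; congr (_ + _).
  have -> : cdiff Y i (h i x.2) =
      g (i + 1) x.2 - f (i + 1) x.2 - h (i + 1) (cdiff X (i + 1) x.2).
    by rewrite hP addrK.
  by rewrite addrA; congr (_ - _); rewrite addrC.
pose FF := mkchain Flin FP.
have -> : dloc D f = dloc D FF \oc dloc D (cyl0 X).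
  rewrite -dloc_comp; apply: dloc_ext => i x /=.
  by rewrite /linear_of_fun /F /= !linear0 !addr0.
have -> : dloc D g = dloc D FF \oc dloc D (cyl1 X).
  rewrite -dloc_comp; apply: dloc_ext => i x /=.
  by rewrite /linear_of_fun /F /= !linear0 !addr0 add0r.
congr (_ \oc _); have [t [ts _]] := dloc_iso (@cylp_quasi_iso X).
have inj u : dloc D (cylp X) \oc u = id1 D X -> u = t.
  by move=> e; rewrite -[u]comp1m -ts -compA e compm1.
have e0 : dloc D (cyl0 X) = t.
  apply: inj; rewrite -dloc_comp -dloc_id; apply: dloc_ext => i x.
  by rewrite /= /linear_of_fun /= addr0.
have e1 : dloc D (cyl1 X) = t.
  apply: inj; rewrite -dloc_comp -dloc_id; apply: dloc_ext => i x.
  by rewrite /= /linear_of_fun /= add0r.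
by rewrite e0 e1.
Qed.

End Localization.
End ChainMaps.

(** * The injective coresolution *)

Section Coresolution.
Variables (k : fieldType) (Q : quiver) (H : algType k).
Variable b : vertex Q * seq (arrow Q) -> H.
Hypothesis bP : is_path_algebra b.
Variable L : seq (vertex Q * seq (arrow Q)).
Hypothesis LP : forall p, is_path p -> p \in L.

Local Notation e := (idem b).
Local Notation x_ := (arr b).
Let Hfd : fd H := path_algebra_fd bP LP.

Lemma resk_mul_linear (M : lmodType H) (h : H) :
  linear (fun x : resk M => h *: (x : M) : resk M).
Proof. by move=> a x y; rewrite !reskE scalerDr !scalerA mulr_algl mulr_algr. Qed.
Definition resk_mul (M : lmodType H) h : {linear resk M -> resk M} :=
  mklin (@resk_mul_linear M h).

(* Averaging a [k]-linear generalized inverse over the idempotents. *)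
Lemma idem_generalized_inverse (M N : lmodType H) (d : {linear M -> N}) :
  exists2 r : {linear resk N -> resk M}, forall x, d (r (d x)) = d x & idem_compat b r.
Proof.
have [r0 r0P] := generalized_inverse (reskf d).
pose r (y : resk N) : resk M := \sum_v e v *: (r0 (e v *: (y : N)) : M).
have rlin : linear r.
  move=> a x y; rewrite /r scaler_sumr -big_split; apply: eq_bigr => v _ /=.
  by rewrite -!(linearP (resk_mul M (e v))) -(linearP r0) -(linearP (resk_mul N (e v))).
exists (mklin rlin) => [x|w y] /=; rewrite /linear_of_fun /r.
  rewrite linear_sum -[RHS]scale1r -(idem_sum bP) scaler_suml; apply: eq_bigr => v _.
  have := r0P (e v *: x); rewrite /= /linear_of_fun !linearZ /= => ->.
  by rewrite scalerA (idem_mul bP) eqxx.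
rewrite scaler_sumr; apply: eq_bigr => v _; rewrite !scalerA !(idem_mul bP) eq_sym.
by case: eqP => [->//|_]; rewrite !scale0r linear0 scaler0.
Qed.

Definition acyclic (C : cplx H) :=
  forall i (x : C (i + 1)), cdiff C (i + 1) x = 0 -> exists y, cdiff C i y = x.

(** Over the semisimple algebra [E] the complex splits: the contraction is [r (1 - r d)], with [r]
    an [E]-linear generalized inverse of [d]. *)
Lemma acyclic_contraction (C : cplx H) : acyclic C ->
  exists2 h : forall i, {linear resk (C (i + 1)) -> resk (C i)},
    forall i (x : C (i + 1)), cdiff C i (h i x) + h (i + 1) (cdiff C (i + 1) x) = x
    & forall i, idem_compat b (h i).
Proof.
move=> Cac.
have [r rP] : {r : forall i, {linear resk (C (i + 1)) -> resk (C i)} & forall i,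
    (forall x, cdiff C i (r i (cdiff C i x)) = cdiff C i x) /\ idem_compat b (r i)}.
  have R i : {r : {linear resk (C (i + 1)) -> resk (C i)} |
      (forall x, cdiff C i (r (cdiff C i x)) = cdiff C i x) /\ idem_compat b r}.
    by apply: cid; have [r ? ?] := idem_generalized_inverse (cdiff C i); exists r.
  by exists (fun i => sval (R i)); move=> i; case: (R i).
have dlin i : linear (fun x : resk (C (i + 1)) =>
    r i (x - r (i + 1) (cdiff C (i + 1) x : resk _)) : resk (C i)).
  move=> a x y; rewrite -linearP; congr (r i _).
  have -> : cdiff C (i + 1) (a *: x + y) =
      a *: (cdiff C (i + 1) x : resk _) + cdiff C (i + 1) y.
    exact: (linearP (reskf (cdiff C (i + 1)))).
  by rewrite linearP scalerBr opprD addrACA.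
exists (fun i => mklin (dlin i)) => [i x|i v y]; rewrite /= /linear_of_fun.
  have [rP0 _] := rP i; have [rP1 _] := rP (i + 1).
  (* The corrected argument is a cocycle, hence a boundary, on which [d r] is the identity. *)
  have [|y ey] := Cac i (x - r (i + 1) (cdiff C (i + 1) x)).
    by rewrite linearB rP1 subrr.
  have [rP2 _] := rP (i + 1 + 1).
  rewrite -ey rP0 ey cdiffK linear0 subr0.
  by rewrite subrK.
have [_ c0] := rP i; have [_ c1] := rP (i + 1).
rewrite linearZ /= c1 -c0; congr (r i _).
exact: (esym (scalerBr _ (y : C (i + 1)) _)).
Qed.

Definition coresolution_ob (X : cplx H) i : fgmod H :=
  fgmod_of (fd_coind bP LP (fgmod_fd (X (i + 1)) Hfd) (fgmod_fd (X i) Hfd)).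

(* The total complex, shifted by one, of the injective coresolution
   [0 -> X -> Hom_E(H, X) -> prod_a Hom_k(e_(tgt a) H, e_(src a) X) -> 0],
   where [E] is spanned by the idempotents; the shift spares transports along
   equalities of degrees. *)
Program Definition coresolution (X : cplx H) : cplx H :=
  @Cplx _ _ (coresolution_ob X)
    (fun i => coind_diff bP (cdiff X i) (cdiff X (i + 1))) _ _.
Next Obligation.
apply: coind_eq => [h|c h].
  by rewrite !coind_diffE1 linearN cdiffK !oppr0.
rewrite !(coind_diffE2, coind_diffE1) coindE linearD linearB cdiffK addr0.
by rewrite [cdiff X (i + 1) (_ *: _)]linearZ /= scalerN opprK addrACA addNr subrr addr0.
Qed.
Next Obligation.
have [N hN] := cbounded X; exists N.+1 => i hi f.
by apply: coind_eq => [h|c h]; rewrite coindE; apply: hN; lia.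
Qed.

(** Although it represents [X[1]], the complex contains [X i] in degree [i], so the bound is [a]
    rather than [a - 1]. *)
Lemma coresolution_strict_le (X : cplx H) a :
  strict_le X a -> strict_le (coresolution X) a.
Proof.
move=> Xa i ai f; apply: coind_eq => [h|c h]; rewrite coindE; apply: Xa; lia.
Qed.

Lemma coresolution_strict_le1 (X : cplx H) a :
  strict_le X a -> strict_le (coresolution (shift X)) (a - 1).
Proof.
move=> Xa i ai f; apply: coind_eq => [h|c h]; rewrite coindE; apply: Xa; lia.
Qed.

Section CoresolutionMap.
Variable X : cplx H.

Let idP i : idem_compat b (idfun : {linear resk (X (i + 1)) -> resk (X (i + 1))}).
Proof. by []. Qed.
Let zeroP i : @arr_compat _ _ _ b (X (i + 1)) (X i) (fun=> \0).
Proof. by split=> // c y; rewrite scaler0. Qed.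

Program Definition coresolution_map : chain_map (shift X) (coresolution X) :=
  @ChainMap _ _ (shift X) (coresolution X) (fun i => to_coind (@idP i) (@zeroP i)) _.
Next Obligation.
apply: coind_eq => [h|c h].
  by rewrite coind_diffE1 !to_coindE1 /= linearZ /= scalerN.
by rewrite coind_diffE2 !to_coindE1 to_coindE2 /= linear0 addr0 scalerA subrr.
Qed.

(** Evaluation at 1 gives injectivity on cohomology; surjectivity comes from the exactness of the
    coresolution. *)
Lemma coresolution_map_quasi_iso : quasi_iso coresolution_map.
Proof.
move=> i; split.
  move=> x _ [f /(congr1 (fun g => cph g 1))].
  rewrite coind_diffE1 to_coindE1 /= scale1r => <-.
  (* The differential of [shift X] is [-d], which matches the sign in [coind_diff]. *)
  by exists (cph f 1).
move=> f df.
have [g [g0 gP]] := coind_delta_surj bP LP (X i) f.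
have f1 h : cdiff X (i + 1 + 1) (cph f h) = 0.
  have := congr1 (fun g => cph g h) df; rewrite coind_diffE1 coindE => /eqP.
  by rewrite oppr_eq0 => /eqP.
have f2 c h : cph f (x_ c * h) - x_ c *: cph f h + cdiff X (i + 1) (cps f c h) = 0.
  by have := congr1 (fun g => cps g c h) df; rewrite coind_diffE2 coindE.
(* Subtracting the boundary of [g] removes the second component of [f]; the first then commutes with
   the arrows and is [h |-> h m] for [m] its value at 1. *)
pose f' : coind b (X (i + 1 + 1)) (X (i + 1)) :=
  f - coind_diff bP (cdiff X i) (cdiff X (i + 1)) g.
have f'E h : cph f' h = cph f h + cdiff X (i + 1) (cph g h).
  by rewrite /f' coindE -[cph (- _) h]/(- - cdiff X (i + 1) (cph g h)) opprK.
have f'P : forall h, cph f' h = h *: cph f' 1.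
  apply: (coind_delta_eq0 bP) => c h; rewrite !f'E.
  have e1 := gP c h; have := f2 c h.
  rewrite -e1 linearB [cdiff _ _ (_ *: _)]linearZ /= => <-.
  by rewrite scalerDr opprD addrACA.
exists (cph f' 1).
  by rewrite -[LHS]/(- cdiff X (i + 1 + 1) (cph f' 1)) f'E linearD f1 cdiffK addr0 oppr0.
exists g; apply: coind_eq => [h|c h].
  rewrite coind_diffE1
    -[RHS]/(cph f h - cph (to_coind (@idP (i + 1)) (@zeroP (i + 1)) (cph f' 1)) h).
  by rewrite to_coindE1 -[X in _ - X]/(h *: cph f' 1) -f'P f'E opprD addrA subrr add0r.
rewrite coind_diffE2
  -[RHS]/(cps f c h - cps (to_coind (@idP (i + 1)) (@zeroP (i + 1)) (cph f' 1)) c h).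
by rewrite to_coindE2 /= gP g0 linear0 subr0 addr0.
Qed.

End CoresolutionMap.
End Coresolution.

(** * The mapping cone *)

Section Cone.
Variables (k : fieldType) (H : algType k).
Hypothesis Hfd : fd H.
Variables (Y Y' : cplx H) (s : chain_map Y Y').

Definition cone_diff_fun i (x : fgprod Hfd (Y' i) (Y (i + 1))) :
    fgprod Hfd (Y' (i + 1)) (Y (i + 1 + 1)) :=
  (cdiff Y' i x.1 + s (i + 1) x.2, - cdiff Y (i + 1) x.2).

Lemma cone_diff_linear i : linear (@cone_diff_fun i).
Proof.
move=> a x y; rewrite /cone_diff_fun /= !linearP /=; congr (_, _).
rewrite -[RHS]/(a *: (cdiff Y' i x.1 + s (i + 1) x.2) + (cdiff Y' i y.1 + s (i + 1) y.2)).
by rewrite scalerDr addrACA.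
Qed.

Program Definition cone : cplx H :=
  @Cplx _ _ (fun i => fgprod Hfd (Y' i) (Y (i + 1)))
    (fun i => mklin (@cone_diff_linear i)) _ _.
Next Obligation.
rewrite /linear_of_fun /cone_diff_fun /=.
rewrite (linearD (cdiff Y' (i + 1))) cdiffK add0r cmapP.
by rewrite (linearN (s (i + 1 + 1))) subrr (linearN (cdiff Y (i + 1 + 1))) cdiffK !oppr0.
Qed.
Next Obligation.
have [N hN] := cbounded Y; have [N' hN'] := cbounded Y'.
exists (N + N').+1 => i hi [x y].
by rewrite (hN' i _ x) ?(hN _ _ y) //; lia.
Qed.

Lemma cone_diffE i (x : Y' i) (y : Y (i + 1)) :
  cdiff cone i (x, y) = (cdiff Y' i x + s (i + 1) y, - cdiff Y (i + 1) y).
Proof. by []. Qed.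

(** Injectivity of [s] on cohomology makes [y] a boundary [d w]; surjectivity then writes the
    cocycle [y' + s w] as [s x] plus a boundary. *)
Lemma cone_acyclic : quasi_iso s -> acyclic cone.
Proof.
move=> sq i [y' y]; rewrite cone_diffE => /= -[e1 /eqP]; rewrite oppr_eq0 => /eqP e2.
have [|w ew] := (sq (i + 1)).1 y e2.
  by exists (- y'); rewrite linearN; apply/eqP; rewrite eqr_oppLR -addr_eq0 e1.
have [|x ex [w' ew']] := (sq i).2 (y' + s (i + 1) w).
  by rewrite linearD cmapP ew.
exists (w', x - w); rewrite cone_diffE ew' linearB linearB ex ew sub0r opprK.
by rewrite addrA subrK addrK.
Qed.

End Cone.

(** * K-injectivity of the coresolution *)

Section Injectivity.
Variables (k : fieldType) (Q : quiver) (H : algType k).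
Variable b : vertex Q * seq (arrow Q) -> H.
Hypothesis bP : is_path_algebra b.
Variable L : seq (vertex Q * seq (arrow Q)).
Hypothesis LP : forall p, is_path p -> p \in L.

Local Notation e := (idem b).
Local Notation x_ := (arr b).
Let Hfd : fd H := path_algebra_fd bP LP.
Local Notation J := (coresolution bP LP).

Section NullHomotopy.
Variables (C X : cplx H) (G : forall i, {linear C i -> J X (i + 1)}).
Hypothesis C_acyclic : acyclic C.
Hypothesis GP : forall i y, cdiff (J X) (i + 1) (G i y) = - G (i + 1) (cdiff C i y).

(** The pair corresponding to [G] under the adjunction; [GP1] and [GP2] are the two components of
    [GP] at 1. *)
Let u0 i : {linear resk (C i) -> resk (X (i + 1 + 1))} := coind_phi (G i).
Let w0 i c : {linear resk (C i) -> resk (X (i + 1))} := coind_psi (G i) c.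

Let GP1 i (y : C i) : cdiff X (i + 1 + 1) (u0 i y) = u0 (i + 1) (cdiff C i y).
Proof.
have := congr1 (fun g => cph g 1) (GP y).
by rewrite coind_diffE1 -[RHS]/(- u0 (i + 1) (cdiff C i y)) => /oppr_inj.
Qed.

Let GP2 i c (y : C i) :
  u0 i (x_ c *: y) - x_ c *: (u0 i y : X (i + 1 + 1)) + cdiff X (i + 1) (w0 i c y) =
  - w0 (i + 1) c (cdiff C i y).
Proof.
have := congr1 (fun g => cps g c 1) (GP y).
rewrite coind_diffE2 -[RHS]/(- w0 (i + 1) c (cdiff C i y)) => <-.
by rewrite /u0 coind_phiE mulr1.
Qed.

(* An [H]-linear map into the coresolution amounts to a pair [(u, w)] of [E]-linear
   maps.  Composition with a contraction [h] kills first the [u]-part of [G], then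
   what is left of the [w]-part; no induction on the degree is needed. *)
Lemma coresolution_null_homotopic :
  exists K : forall i, {linear C i -> J X i},
    forall i y, G i y = cdiff (J X) i (K i y) - K (i + 1) (cdiff C i y).
Proof.
have [h hP h_compat] := acyclic_contraction bP C_acyclic.
pose u := @reindex_fam (fun i => {linear resk (C i) -> resk (X (i + 1))})
  (fun i => \- (u0 i \o h i)).
have uE i y : u (i + 1) y = - u0 i (h i y) by rewrite /u reindex_famE.
have u_compat : forall i, idem_compat b (u i).
  apply: reindex_fam => i v y; rewrite !uE h_compat.
  by rewrite (coind_phi_compat (G i)); apply/esym/(@scalerN _ (X (i + 1 + 1))).
have uP : forall i (y : C i), - cdiff X (i + 1) (u i y) - u (i + 1) (cdiff C i y) = u0 i y.
  apply: reindex_fam => i y; rewrite !uE linearN !opprK GP1.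
  by rewrite -(linearD (u0 (i + 1))) hP.
(* What remains of the second component of [G] once the contribution of [u] is subtracted; by [w1P]
   it anticommutes with the differentials, so the contraction applies again. *)
pose w1 i c := (w0 i c \+ (\- (u i \o resk_mul (C i) (x_ c)) \+
  (resk_mul (X (i + 1)) (x_ c) \o u i)) : {linear resk (C i) -> resk (X (i + 1))}).
have w1E i c (y : C i) :
    w1 i c y = w0 i c y + (- u i (x_ c *: y) + x_ c *: (u i y : X (i + 1))).
  by [].
have w1_compat i : arr_compat b (w1 i).
  have [w0s w0t] := coind_psi_compat (G i).
  split=> c y; rewrite !w1E.
    rewrite scalerDr w0s scalerDr scalerN -u_compat !scalerA.
    by rewrite (idem_mul_arr bP) eqxx.
  by rewrite w0t scalerA u_compat scalerA (arr_mul_idem bP) eqxx.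
have w1P i c (z : C i) : cdiff X (i + 1) (w1 i c z) = - w1 (i + 1) c (cdiff C i z).
  have du y : cdiff X (i + 1) (u i y) = - (u0 i y + u (i + 1) (cdiff C i y)).
    by rewrite -uP subrK opprK.
  have dxu : cdiff X (i + 1) (x_ c *: (u i z : X (i + 1))) =
      x_ c *: cdiff X (i + 1) (u i z).
    by rewrite linearZ.
  rewrite !w1E [RHS]opprD [in RHS](opprD (- _)) -(GP2 c z) opprK.
  have <- : cdiff C i (x_ c *: z) = x_ c *: cdiff C i z by rewrite linearZ.
  rewrite linearD linearD linearN dxu !du opprK.
  rewrite scalerN scalerDr opprD.
  by rewrite (addrACA (u0 i _)) (addrCA (cdiff _ _ _)) [LHS]addrA.
pose w := @reindex_fam (fun i => arrow Q -> {linear resk (C i) -> resk (X i)})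
  (fun i c => \- (w1 i c \o h i)).
have wE i c y : w (i + 1) c y = - w1 i c (h i y) by rewrite /w reindex_famE.
have w_compat : forall i, arr_compat b (w i).
  apply: reindex_fam => i; have [w1s w1t] := w1_compat i; split=> c y; rewrite !wE.
    by rewrite scalerN w1s.
  by rewrite h_compat w1t.
have wP : forall i c (y : C i), cdiff X i (w i c y) - w (i + 1) c (cdiff C i y) = w1 i c y.
  apply: reindex_fam => i c y; rewrite !wE linearN !opprK w1P opprK.
  by rewrite -(linearD (w1 (i + 1) c)) hP.
exists (fun i => to_coind (u_compat i) (w_compat i)) => i y.
apply: coind_eq => [x|c x].
  rewrite -[RHS]/(- cdiff X (i + 1) (u i (x *: y)) - u (i + 1) (x *: cdiff C i y)).
  have <- : cdiff C i (x *: y) = x *: cdiff C i y by rewrite linearZ.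
  by rewrite uP /u0 coind_phiE.
rewrite -[RHS]/(u i ((x_ c * x) *: y) - x_ c *: (u i (x *: y) : X (i + 1)) +
  cdiff X i (w i c (x *: y)) - w (i + 1) c (x *: cdiff C i y)).
have <- : cdiff C i (x *: y) = x *: cdiff C i y by rewrite linearZ.
rewrite -[RHS]addrA (wP i c (x *: y)) w1E -scalerA.
by rewrite addrCA addrACA subrr addNr !addr0 /w0 coind_psiE.
Qed.

End NullHomotopy.
End Injectivity.

(** * Morphisms into the coresolution are chain maps *)

Section Representability.
Variables (k : fieldType) (Q : quiver) (H : algType k).
Variable b : vertex Q * seq (arrow Q) -> H.
Hypothesis bP : is_path_algebra b.
Variable L : seq (vertex Q * seq (arrow Q)).
Hypothesis LP : forall p, is_path p -> p \in L.
Let Hfd : fd H := path_algebra_fd bP LP.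
Local Notation J := (coresolution bP LP).

(** On the acyclic cone of [s], the map [g] of the second coordinate is null-homotopic through some
    [K]; [- K(y', 0)] is the extension and [K(0, y)] the homotopy. *)
Lemma coresolution_extend (X Y Y' : cplx H) (s : chain_map Y Y') (g : chain_map Y (J X)) :
  quasi_iso s -> exists g' : chain_map Y' (J X), homotopic (chain_comp g' s) g.
Proof.
move=> sq.
have Glin i : linear (fun c : cone Hfd s i => g (i + 1) c.2).
  by move=> a x y; rewrite /= linearP.
have [|K KP] := @coresolution_null_homotopic _ _ _ _ bP _ LP (cone Hfd s) X
  (fun i => mklin (@Glin i)) (cone_acyclic sq).
  move=> i [y' y].
  rewrite -[LHS]/(cdiff (J X) (i + 1) (g (i + 1) y)) cmapP.
  rewrite -[RHS]/(- g (i + 1 + 1) (- cdiff Y (i + 1) y)).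
  by rewrite (linearN (g (i + 1 + 1))) opprK.
have K0 i (y' : Y' i) : cdiff (J X) i (K i (y', 0)) = K (i + 1) (cdiff Y' i y', 0).
  have := KP i (y', 0); rewrite cone_diffE -[LHS]/(g (i + 1) 0) !linear0 addr0.
  by move=> /esym/eqP; rewrite subr_eq0 => /eqP.
have g'lin i : linear (fun y' : Y' i => - K i (y', 0)).
  move=> a x y; rewrite scalerN -opprD; congr (- _); rewrite -linearP; congr (K i _).
  by congr (_, _); rewrite /= scaler0 addr0.
have g'P i y' : cdiff (J X) i (- K i (y', 0)) = - K (i + 1) (cdiff Y' i y', 0).
  by rewrite linearN K0.
have hlin i : linear (fun y : Y (i + 1) => K i (0, y)).
  move=> a x y; rewrite -linearP; congr (K i _).
  by congr (_, _); rewrite /= scaler0 addr0.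
exists (@mkchain _ _ Y' (J X) _ g'lin g'P), (fun i => mklin (hlin i)) => i y.
rewrite -[LHS]/(g (i + 1) y - - K (i + 1) (s (i + 1) y, 0)) opprK.
have := KP i (0, y); rewrite cone_diffE linear0 add0r -[LHS]/(g (i + 1) y) => ->.
rewrite -addrA -[RHS]/(_ + K (i + 1) (0, cdiff Y (i + 1) y)); congr (_ + _).
apply/eqP; rewrite addrC subr_eq -linearD; apply/eqP; congr (K _ _).
by congr (_, _); rewrite /= ?add0r ?subrr.
Qed.

Variable D : derived_category H.

Lemma sig_eq (T : Type) (P : T -> Prop) (x y : {z : T | P z}) : sval x = sval y -> x = y.
Proof.
by case: x y => [x px] [y py] /= e; subst y; rewrite (Prop_irrelevance px py).
Qed.

Section Extendable.
Variable X : cplx H.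

Definition extendable Y Y' (f : hom D Y Y') :=
  forall g : chain_map Y' (J X), exists g', dloc D g' = dloc D g \oc f.

(* The extendable morphisms form a subcategory containing the chain maps and the
   inverses of quasi-isomorphisms; the localization functor factors through it, and
   by uniqueness it is the whole category. *)
Lemma extendable1 Y : extendable (id1 D Y).
Proof. by move=> g; exists g; rewrite compm1. Qed.

Lemma extendable_comp Y Y' Y'' (g : hom D Y' Y'') (f : hom D Y Y') :
  extendable g -> extendable f -> extendable (g \oc f).
Proof.
move=> hg hf u; have [v ev] := hg u; have [w ew] := hf v.
by exists w; rewrite ew ev compA.
Qed.

Lemma extendable_dloc Y Y' (f : chain_map Y Y') : extendable (dloc D f).
Proof. by move=> g; exists (chain_comp g f); rewrite dloc_comp. Qed.

Lemma extendable_inv Y Y' (s : chain_map Y Y') (t : hom D Y' Y) : quasi_iso s ->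
  dloc D s \oc t = id1 D Y' -> extendable t.
Proof.
move=> sq st g; have [g' /(homotopic_dloc Hfd D) e] := coresolution_extend g sq.
by exists g'; rewrite -e dloc_comp -compA st compm1.
Qed.

Definition extendable_category : category (cplx H).
refine (@Category (cplx H) (fun Y Y' => {f : hom D Y Y' | extendable f})
  (fun Y => exist _ (id1 D Y) (@extendable1 Y))
  (fun Y Y' Y'' g f =>
     exist _ (sval g \oc sval f) (extendable_comp (svalP g) (svalP f))) _ _ _).
- by move=> Y Y' f; apply: sig_eq; apply: comp1m.
- by move=> Y Y' f; apply: sig_eq; apply: compm1.
- by move=> Y Y' Z Z' f g h; apply: sig_eq; apply: compA.
Defined.

Lemma all_extendable Y Y' (f : hom D Y Y') : extendable f.
Proof.
have [Dfun Diso Duniv] := dlocP D.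
pose G Y Y' (f : mor (complexes H) Y Y') : mor extendable_category (id Y) (id Y') :=
  exist _ (dloc D f) (extendable_dloc f).
have [||G' [[G'1 G'2] G'P] _] := Duniv _ extendable_category id G.
- by split=> [Z|Z Z' Z'' u v]; apply: sig_eq; [apply: Dfun.1|apply: Dfun.2].
- move=> Z Z' s sq; have [t [ts st]] := Diso _ _ _ sq.
  exists (exist _ t (extendable_inv sq st)); split; exact: sig_eq.
(* The identity of [D] and the composite of [G'] with the inclusion both extend [dloc], so both
   equal [G0]. *)
have [|] := Duniv _ (category_of_lincat D) id (@dloc _ _ D) Dfun; first exact: Diso.
move=> G0 _ uniq.
have e1 : f = G0 _ _ f by apply: (uniq (fun _ _ u => u)).
have e2 : sval (G' _ _ f) = G0 _ _ f.
  apply: (uniq (fun _ _ u => sval (G' _ _ u))).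
    by split=> [Z|Z Z' Z'' u v]; rewrite ?G'1 ?G'2.
  by move=> Z Z' u; rewrite G'P.
by rewrite e1 -e2; apply: svalP.
Qed.

End Extendable.

(** Extendability of [f] is applied to the identity chain map of [J X]. *)
Lemma hom_coresolution Y X (f : hom D Y (J X)) : exists g : chain_map Y (J X), f = dloc D g.
Proof.
have [g e] := all_extendable f (chain_id (J X)).
by exists g; rewrite e dloc_id comp1m.
Qed.

Lemma coresolution_dloc_iso X : exists2 t : hom D (J X) (shift X),
  t \oc dloc D (coresolution_map bP LP X) = id1 D _ &
  dloc D (coresolution_map bP LP X) \oc t = id1 D _.
Proof.
by have [t []] := dloc_iso D (coresolution_map_quasi_iso bP LP X); exists t.
Qed.

Lemma hom_shift Y X (f : hom D Y (shift X)) : exists g : chain_map Y (J X),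
  dloc D (coresolution_map bP LP X) \oc f = dloc D g.
Proof. exact: hom_coresolution. Qed.

(** In every degree the source or the target of a chain map from [Y] to [J X] is zero. *)
Lemma hom_shift_eq0 Y X (a c : int) : strict_ge Y c -> strict_le (J X) a -> (a < c)%R ->
  forall f : hom D Y (shift X), f = 0.
Proof.
move=> Yc Xa ac f; have [g e] := hom_shift f; have [t tm _] := coresolution_dloc_iso X.
rewrite -[f]comp1m -tm -compA e dloc0 ?comp0r // => i x.
have [ci|ic] : (i < c)%R \/ (a < i)%R by lia.
  by rewrite (Yc i ci x) linear0.
exact: Xa.
Qed.

End Representability.

(** * The vector space of chain maps *)

Section ChainMapSpace.
Variables (k : fieldType) (H : algType k) (X Y : cplx H).

HB.instance Definition _ := gen_eqMixin (chain_map X Y).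
HB.instance Definition _ := gen_choiceMixin (chain_map X Y).

(** The scalars [a%:A] are central in [H], so the combination remains [H]-linear. *)
Fact chain_lin_linear (a : k) (f g : chain_map X Y) i :
  linear (fun x : X i => a%:A *: f i x + g i x).
Proof.
move=> h x y; rewrite !linearP !scalerDr !scalerA mulr_algl mulr_algr.
exact: addrACA.
Qed.

Program Definition chain_lin (a : k) (f g : chain_map X Y) : chain_map X Y :=
  mkchain (@chain_lin_linear a f g) _.
Next Obligation. by rewrite linearP /= !cmapP. Qed.

Program Definition chain0 : chain_map X Y := @ChainMap _ _ X Y (fun i => \0) _.
Next Obligation. by rewrite linear0. Qed.

Definition chain_add := chain_lin 1.
Definition chain_scale a f := chain_lin a f chain0.

Lemma chain_linE a f g i x : chain_lin a f g i x = a%:A *: f i x + g i x.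
Proof. by []. Qed.
Lemma chain_addE f g i x : chain_add f g i x = f i x + g i x.
Proof. by rewrite chain_linE !scale1r. Qed.
Lemma chain_scaleE a f i x : chain_scale a f i x = a%:A *: f i x.
Proof. by rewrite chain_linE addr0. Qed.

Fact chain_addA : associative chain_add.
Proof. by move=> f g h; apply: chain_map_eq => i x; rewrite !chain_addE addrA. Qed.
Fact chain_addC : commutative chain_add.
Proof. by move=> f g; apply: chain_map_eq => i x; rewrite !chain_addE addrC. Qed.
Fact chain_add0 : left_id chain0 chain_add.
Proof. by move=> f; apply: chain_map_eq => i x; rewrite !chain_addE add0r. Qed.
Fact chain_addN : left_inverse chain0 (chain_scale (-1)) chain_add.
Proof.
move=> f; apply: chain_map_eq => i x.
by rewrite chain_addE chain_scaleE scaleN1r scaleN1r addNr.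
Qed.
HB.instance Definition _ := GRing.isZmodule.Build (chain_map X Y)
  chain_addA chain_addC chain_add0 chain_addN.

Fact chain_scaleA a c f : chain_scale a (chain_scale c f) = chain_scale (a * c) f.
Proof.
by apply: chain_map_eq => i x; rewrite !chain_scaleE scalerA mulr_algl scalerA.
Qed.
Fact chain_scale1 : left_id 1 chain_scale.
Proof. by move=> f; apply: chain_map_eq => i x; rewrite !chain_scaleE !scale1r. Qed.
Fact chain_scaleDr : right_distributive chain_scale +%R.
Proof.
move=> a f g; apply: chain_map_eq => i x.
by rewrite !(chain_scaleE, chain_addE) scalerDr.
Qed.
Fact chain_scaleDl f : {morph chain_scale^~ f : a c / a + c}.
Proof.
move=> a c; apply: chain_map_eq => i x.
by rewrite !(chain_scaleE, chain_addE) !scalerDl.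
Qed.
HB.instance Definition _ := GRing.Zmodule_isLmodule.Build k (chain_map X Y)
  chain_scaleA chain_scale1 chain_scaleDr chain_scaleDl.

Lemma chain_map_linE a (f g : chain_map X Y) i x : (a *: f + g) i x = a%:A *: f i x + g i x.
Proof. by rewrite [LHS]chain_addE chain_scaleE. Qed.

(** A chain map is determined by its values on generators in the degrees from [-N] to [N]. *)
Lemma fd_chain_map : fd H -> fd (chain_map X Y).
Proof.
move=> Hfd; have [N hN] := cbounded X.
have gen i : {n : nat & {e : 'I_n -> X i |
    forall x, exists c : 'I_n -> H, x = \sum_j c j *: e j}}.
  by have /cid[n /cid[e es]] := fgcarP (X i); exists n, e.
pose e i := sval (projT2 (gen i)).
pose W i : lmodType k := {ffun 'I_(projT1 (gen i)) -> resk (Y i)}.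
pose ev i (f : chain_map X Y) : W i := [ffun j => f i (e i j)].
have evlin i : linear (ev i).
  by move=> a f g; apply/ffunP => j; rewrite !ffunE chain_map_linE.
pose L : seq int := [seq Posz j - Posz N | j <- iota 0 (N + N).+1].
apply: (@fd_joint _ _ L _ W (fun i => mklin (evlin i))) => [i _|f f0].
  by apply/fd_ffun/fgmod_fd.
apply: chain_map_eq => i x; rewrite -[RHS]/0.
have [iN|Ni] := leqP `|i|%N N; last by rewrite (hN i Ni x) linear0.
have iL : i \in L.
  by apply/mapP; exists (absz (i + Posz N)); rewrite ?mem_iota; lia.
have /ffunP fe := f0 i iL.
have [c ->] := svalP (projT2 (gen i)) x; rewrite linear_sum big1 // => j _.
have := fe j; rewrite /= /linear_of_fun !ffunE => fej.
by rewrite linearZ /= fej scaler0.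
Qed.

End ChainMapSpace.

Section HomFinite.
Variables (k : fieldType) (Q : quiver) (H : algType k).
Variable b : vertex Q * seq (arrow Q) -> H.
Hypothesis bP : is_path_algebra b.
Variable L : seq (vertex Q * seq (arrow Q)).
Hypothesis LP : forall p, is_path p -> p \in L.
Variable D : derived_category H.

Lemma fd_hom_shift (Y X : cplx H) : fd (hom D Y (shift X)).
Proof.
have [t tm mt] := coresolution_dloc_iso bP LP D X.
pose F (g : chain_map Y (coresolution bP LP X)) : hom D Y (shift X) := t \oc dloc D g.
have Flin : linear F.
  move=> a f g; rewrite /F -compZr -compDr; congr (_ \oc _).
  by apply: dloc_linear => i x; rewrite chain_map_linE.
apply: (@fd_surj _ _ _ (mklin Flin)); last exact/fd_chain_map/(path_algebra_fd bP LP).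
move=> f; have [g e] := hom_shift bP LP f.
by exists g; rewrite /= /linear_of_fun /F -e compA tm comp1m.
Qed.

End HomFinite.

(** * Cohomology and truncation *)

Section Cohomology.
Variables (k : fieldType) (H : algType k) (i : int).
Implicit Types X Y Z : cplx H.

(** A coset of the boundaries, as a predicate: cohomology is then a set of predicates and needs no
    quotient. *)
Definition coh_class X (x y : X (i + 1)) : Prop := exists w, cdiff X i w = y - x.

Lemma coh_class_eq X (x x' : X (i + 1)) :
  coh_class x = coh_class x' <-> exists w, cdiff X i w = x - x'.
Proof.
split=> [e|[w ew]].
  have : coh_class x x by exists 0; rewrite linear0 subrr.
  by rewrite e.
apply/funext => y; apply/propext; split=> -[v ev].
  by exists (v + w); rewrite linearD ev ew addrA subrK.
by exists (v - w); rewrite linearB ev ew opprB addrA subrK.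
Qed.

Definition coh X := {c : X (i + 1) -> Prop |
  exists x, cdiff X (i + 1) x = 0 /\ c = coh_class x}.

Definition coh_of X (x : X (i + 1)) (dx : cdiff X (i + 1) x = 0) : coh X :=
  exist _ (coh_class x) (ex_intro _ x (conj dx erefl)).

Definition coh_rep X (c : coh X) := sval (cid (svalP c)).

Lemma coh_repP X (c : coh X) : cdiff X (i + 1) (coh_rep c) = 0.
Proof. by case: (svalP (cid (svalP c))). Qed.

Lemma coh_repE X (c : coh X) : sval c = coh_class (coh_rep c).
Proof. by case: (svalP (cid (svalP c))). Qed.

Fact coh_map_subproof X Y (f : chain_map X Y) (c : coh X) :
  cdiff Y (i + 1) (f (i + 1) (coh_rep c)) = 0.
Proof. by rewrite cmapP coh_repP linear0. Qed.
Definition coh_map X Y (f : chain_map X Y) (c : coh X) : coh Y :=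
  coh_of (coh_map_subproof f c).

Lemma coh_mapE X Y (f : chain_map X Y) (c : coh X) x :
  sval c = coh_class x -> sval (coh_map f c) = coh_class (f (i + 1) x).
Proof.
move=> e; apply/coh_class_eq.
have /coh_class_eq[w ew] : coh_class (coh_rep c) = coh_class x by rewrite -coh_repE.
by exists (f i w); rewrite cmapP ew linearB.
Qed.

(** Mere maps of sets suffice for the universal property; the objects remain the complexes. *)
Definition coh_category : category (cplx H).
refine (@Category (cplx H) (fun X Y => coh X -> coh Y)
  (fun X c => c) (fun X Y Z g f c => g (f c)) _ _ _); by [].
Defined.

Variable D : derived_category H.

(** Cohomology inverts quasi-isomorphisms, hence factors through [D], where [f] and the zero map
    agree. *)
Lemma dloc_eq0_cohomology X Y (f : chain_map X Y) : dloc D f = 0 ->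
  forall x, cdiff X (i + 1) x = 0 -> exists w, cdiff Y i w = f (i + 1) x.
Proof.
move=> f0 x dx; have [_ _ Duniv] := dlocP D.
have [||G' [_ G'P] _] := Duniv _ coh_category id coh_map.
- split=> [Z|Z Z' Z'' u v]; apply/funext => c; apply: sig_eq.
    by rewrite (coh_mapE _ (coh_repE c)) -coh_repE.
  rewrite (coh_mapE _ (coh_repE c)).
  by rewrite (@coh_mapE _ _ u (coh_map v c) (v (i + 1) (coh_rep c))).
- move=> Z Z' s sq; have [s1 s2] := sq i.
  have inj c c' : coh_map s c = coh_map s c' -> c = c'.
    move=> /(congr1 sval)/coh_class_eq; rewrite -linearB => e.
    apply: sig_eq; rewrite !coh_repE; apply/coh_class_eq; apply: s1 => //.
    by rewrite linearB !coh_repP subrr.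
  have surj c : exists c', coh_map s c' = c.
    have [z dz [w ew]] := s2 _ (coh_repP c).
    exists (coh_of dz); apply: sig_eq; rewrite (@coh_mapE _ _ s (coh_of dz) z erefl).
    rewrite coh_repE; apply/coh_class_eq; exists (- w).
    by rewrite linearN ew opprB.
  have [t tP] := boolp.choice surj.
  exists t; split; apply/funext => c //=; by apply: inj; apply: tP.
have e : coh_map f = coh_map (chain0 X Y) by rewrite -!G'P f0 dloc0.
have := congr1 (fun g => sval (g (coh_of dx))) e.
rewrite (@coh_mapE _ _ f (coh_of dx) x erefl).
rewrite (@coh_mapE _ _ (chain0 X Y) (coh_of dx) x erefl) => /coh_class_eq[w].
by rewrite subr0 => ew; exists w.
Qed.

End Cohomology.

Section Submodule.
Variables (R : nzRingType) (M : lmodType R) (S : M -> Prop).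
Hypothesis S_closed : S 0 /\ forall a x y, S x -> S y -> S (a *: x + y).

Definition submod_pred : {pred M} := fun x => `[< S x >].
Fact submod_predP : submod_closed submod_pred.
Proof.
have [S0 Slin] := S_closed; split; first exact/asboolP.
by move=> a x y /asboolP Sx /asboolP Sy; apply/asboolP/Slin.
Qed.

Record submod_of (h : submod_closed submod_pred) := Submod {
  submod_val : M; submodP : submod_val \in submod_pred }.
Definition submod := submod_of submod_predP.

HB.instance Definition _ := [isSub of submod for @submod_val submod_predP].
HB.instance Definition _ := [Choice of submod by <:].
HB.instance Definition _ :=
  GRing.SubChoice_isSubLmodule.Build R M submod_pred submod submod_predP.
Definition submod_val_lin : {linear submod -> M} := val : {linear submod -> M}.

End Submodule.

(** * Truncation, and the detection of cohomology by morphisms *)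

Section Truncation.
Variables (k : fieldType) (Q : quiver) (H : algType k).
Variable b : vertex Q * seq (arrow Q) -> H.
Hypothesis bP : is_path_algebra b.
Variable L : seq (vertex Q * seq (arrow Q)).
Hypothesis LP : forall p, is_path p -> p \in L.
Let Hfd : fd H := path_algebra_fd bP LP.
Variables (Y : cplx H) (a : int).

Section TruncatedComplex.

(** The good truncation: all of [Y i] below [a - 1], the cocycles in degree [a - 1], zero from [a]
    on. *)
Definition in_trunc i (x : Y i) :=
  ((a <= i)%R -> x = 0) /\ ((a <= i + 1)%R -> cdiff Y i x = 0).

Lemma in_trunc_closed i : in_trunc (0 : Y i) /\
  forall h (x y : Y i), in_trunc x -> in_trunc y -> in_trunc (h *: x + y).
Proof.
split=> [|h x y [x1 x2] [y1 y2]]; split=> ai; rewrite ?linear0 //.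
  by rewrite x1 // y1 // scaler0 addr0.
by rewrite linearP x2 // y2 // scaler0 addr0.
Qed.

Notation T i := (submod (in_trunc_closed i)).

Lemma fd_trunc i : fd (resk (T i)).
Proof.
apply: (@fd_inj _ _ _ (reskf (submod_val_lin (in_trunc_closed i)))) (fgmod_fd (Y i) Hfd).
exact: val_inj.
Qed.

Lemma in_trunc_diff i (x : Y i) : in_trunc x -> in_trunc (cdiff Y i x).
Proof. by move=> [x1 x2]; split=> [|_]; [exact: x2|exact: cdiffK]. Qed.

Lemma in_trunc_val i (x : T i) : in_trunc (val x).
Proof. exact/asboolP/submodP. Qed.

Definition trunc_diff_fun i (x : T i) : T (i + 1) :=
  @Submod _ _ _ (submod_predP (in_trunc_closed (i + 1))) (cdiff Y i (val x))
    (asboolT (in_trunc_diff (in_trunc_val x))).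

Lemma trunc_diff_linear i : linear (@trunc_diff_fun i).
Proof. by move=> h x y; apply: val_inj; rewrite /= !linearP. Qed.

Program Definition trunc : cplx H :=
  @Cplx _ _ (fun i => fgmod_of (fd_trunc i)) (fun i => mklin (@trunc_diff_linear i)) _ _.
Next Obligation. by apply: val_inj; rewrite /= cdiffK. Qed.
Next Obligation.
have [N hN] := cbounded Y; exists N => i hi x; apply: val_inj.
by rewrite (hN i hi (val x)) (hN i hi (val 0)).
Qed.

Program Definition trunc_map : chain_map trunc Y :=
  @ChainMap _ _ trunc Y (fun i => submod_val_lin (in_trunc_closed i)) _.

Lemma trunc_strict_le : strict_le trunc (a - 1).
Proof.
move=> i ai x; apply: val_inj; have [x0 _] := in_trunc_val x.
by rewrite x0 ?linear0 //; lia.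
Qed.

Lemma trunc_quasi_iso :
  (forall i (x : Y (i + 1)), (a <= i + 1)%R -> cdiff Y (i + 1) x = 0 ->
     exists y, cdiff Y i y = x) ->
  quasi_iso trunc_map.
Proof.
move=> ac i; have [ai|ia] := boolP (a <= i + 1)%R.
  split=> [x _ _|y dy].
    exists 0; rewrite linear0; apply: val_inj; have [x0 _] := in_trunc_val x.
    by rewrite linear0 x0.
  have [w ew] := ac i y ai dy.
  exists 0; first exact: linear0.
  by exists w; rewrite ew (linear0 (trunc_map (i + 1))) subr0.
split=> [x _ [w ew]|y dy].
  have wT : in_trunc w by split=> ?; exfalso; lia.
  exists (@Submod _ _ _ (submod_predP (in_trunc_closed i)) w (asboolT wT)).
  exact: val_inj.
have yT : in_trunc y by split=> // ?; exfalso; lia.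
exists (@Submod _ _ _ (submod_predP (in_trunc_closed (i + 1))) y (asboolT yT)).
  by apply: val_inj; rewrite /= dy.
by exists 0; rewrite linear0 subrr.
Qed.

End TruncatedComplex.

Section Detection.
Variable D : derived_category H.

Lemma fd_triv : fd (resk 'rV[H]_0).
Proof.
exists 0, (\0 : {linear resk 'rV[H]_0 -> 'rV[k]_0}).
by move=> x y _; apply/rowP; case.
Qed.

(* A cocycle of degree [i >= a] which is not a boundary is detected by a map from [Y] to
   the complex of the injectives [Hom_E(H, Y i)], [i >= a], with zero differential. *)
Definition trunc_ge_ob i : fgmod H := if (a <= i)%R then Y i else fgmod_of fd_triv.

Definition stalks_ob i : fgmod H :=
  fgmod_of (fd_coind bP LP (fgmod_fd (trunc_ge_ob i) Hfd) (fgmod_fd (trunc_ge_ob i) Hfd)).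

Lemma stalks0 i (f : stalks_ob i) : (forall x : trunc_ge_ob i, x = 0) -> f = 0.
Proof. by move=> h; apply: coind_eq => [x|c x]; rewrite coindE; apply: h. Qed.

Program Definition stalks : cplx H := @Cplx _ _ stalks_ob (fun i => \0) _ _.
Next Obligation.
have [N hN] := cbounded Y; exists N => i hi f; apply: stalks0.
rewrite /trunc_ge_ob; case: ifP => _; first exact: hN.
by move=> x; apply/rowP; case.
Qed.

Lemma stalks_strict_ge : strict_ge stalks a.
Proof.
move=> i ia f; apply: stalks0; rewrite /trunc_ge_ob.
case: ifP => [h|_]; first by exfalso; lia.
by move=> x; apply/rowP; case.
Qed.

Definition trunc_ge_map i (v : {linear resk (Y i) -> resk (Y i)}) :
    {linear resk (Y i) -> resk (trunc_ge_ob i)} :=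
  if (a <= i)%R as c
  return {linear resk (Y i) -> resk (if c then Y i else fgmod_of fd_triv)}
  then v else \0.

Lemma trunc_ge_mapP i (v : {linear resk (Y i) -> resk (Y i)}) y :
  (v y = 0 -> trunc_ge_map v y = 0) /\ ((a <= i)%R -> trunc_ge_map v y = 0 -> v y = 0).
Proof. by rewrite /trunc_ge_map /trunc_ge_ob; case: (a <= i)%R. Qed.

Lemma trunc_ge_map_compat i (v : {linear resk (Y i) -> resk (Y i)}) :
  idem_compat b v -> @idem_compat _ _ _ b _ (trunc_ge_ob i) (trunc_ge_map v).
Proof.
rewrite /trunc_ge_map /trunc_ge_ob; case: (a <= i)%R => // _ w y.
by rewrite /= scaler0.
Qed.

Lemma acyclic_of_hom_eq0 :
  (forall W : cplx H, strict_ge W a -> forall f : hom D Y W, f = 0) ->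
  forall i (x : Y (i + 1)), (a <= i + 1)%R -> cdiff Y (i + 1) x = 0 ->
    exists y, cdiff Y i y = x.
Proof.
move=> hom0.
have r i : {r : {linear resk (Y (i + 1)) -> resk (Y i)} |
    (forall x, cdiff Y i (r (cdiff Y i x)) = cdiff Y i x) /\ idem_compat b r}.
  by apply: cid; have [r ? ?] := idem_generalized_inverse bP (cdiff Y i); exists r.
(* The [E]-linear projection [1 - d r] kills boundaries, and [v x = 0] makes [x] the boundary of
   [r x]. *)
pose v := @reindex_fam (fun i => {linear resk (Y i) -> resk (Y i)})
  (fun i => idfun \- (reskf (cdiff Y i) \o sval (r i))).
have vE i (x : Y (i + 1)) : v (i + 1) x = (x : Y (i + 1)) - cdiff Y i (sval (r i) x).
  by rewrite /v reindex_famE.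
have v_compat : forall i, idem_compat b (v i).
  apply: reindex_fam => i w y; rewrite !vE scalerBr.
  by case: (svalP (r i)) => _ ->; rewrite linearZ.
have vd i (x : Y i) : v (i + 1) (cdiff Y i x) = 0.
  by rewrite vE; case: (svalP (r i)) => -> _; rewrite subrr.
have zeroP i : @arr_compat _ _ _ b (Y i) (trunc_ge_ob i) (fun=> \0).
  by split=> // c y; rewrite scaler0.
pose t i : {linear Y i -> stalks i} :=
  to_coind (trunc_ge_map_compat (v_compat i)) (zeroP i).
have tP i x : cdiff stalks i (t i x) = t (i + 1) (cdiff Y i x).
  apply: coind_eq => [h|c h //].
  rewrite -[RHS]/(trunc_ge_map (v (i + 1)) (h *: cdiff Y i x)) -[LHS]/0.
  have <- : cdiff Y i (h *: x) = h *: cdiff Y i x by rewrite linearZ.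
  by have [-> //] := trunc_ge_mapP (v (i + 1)) (cdiff Y i (h *: x)).
pose tt := @ChainMap _ _ Y stalks t tP.
move=> i x ai dx.
(* Boundaries in [stalks] are zero, and evaluation at 1 recovers [v x]. *)
have [w] := dloc_eq0_cohomology (hom0 _ stalks_strict_ge (dloc D tt)) dx.
move=> /(congr1 (fun g => cph g 1)).
rewrite -[LHS]/0 -[RHS]/(trunc_ge_map (v (i + 1)) (1 *: x)) scale1r => /esym e.
have [_ /(_ ai e)] := trunc_ge_mapP (v (i + 1)) x.
rewrite vE => /eqP; rewrite subr_eq0 => /eqP ->.
by exists (sval (r i) x).
Qed.

Lemma truncation :
  (forall W : cplx H, strict_ge W a -> forall f : hom D Y W, f = 0) ->
  exists2 Y' : cplx H, strict_le Y' (a - 1) & exists s : chain_map Y' Y, quasi_iso s.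
Proof.
move=> /acyclic_of_hom_eq0 ac; exists trunc; first exact: trunc_strict_le.
by exists trunc_map; apply: trunc_quasi_iso.
Qed.

End Detection.
End Truncation.

(** * The cluster category *)

Section LinearCategory.
Variables (k : fieldType).

Section Embeddings.
Variables (ob : Type) (C : lincat k ob).
Implicit Types X Y Z : ob.

Definition isom X Y := exists f : hom C X Y, is_iso (C := C) f.

Lemma isom_sym X Y : isom X Y -> isom Y X.
Proof. by move=> [f [g [gf fg]]]; exists g, f. Qed.

Lemma isom_trans X Y Z : isom X Y -> isom Y Z -> isom X Z.
Proof.
move=> [f [g /= [gf fg]]] [f' [g' /= [gf' fg']]].
exists (f' \oc f), (g \oc g'); split => /=.
  by rewrite compA -[g \oc g' \oc f']compA gf' compm1.
by rewrite compA -[f' \oc f \oc g]compA fg compm1.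
Qed.

(** Injections, rather than isomorphisms, already transfer vanishing and finite dimension. *)
Definition hom_emb X Y ob' (C' : lincat k ob') (X' Y' : ob') :=
  exists f : {linear hom C X Y -> hom C' X' Y'}, injective f.

Lemma hom_emb_isol X X' Y : isom X X' -> hom_emb X Y C X' Y.
Proof.
move=> [f [g /= [gf fg]]].
have l : linear (fun u : hom C X Y => u \oc g) by move=> a u v; rewrite compDl compZl.
exists (mklin l) => u v /(congr1 (fun w => w \oc f)).
by rewrite /= /linear_of_fun -!compA gf !compm1.
Qed.

Lemma hom_emb_isor X Y Y' : isom Y Y' -> hom_emb X Y C X Y'.
Proof.
move=> [f [g /= [gf fg]]].
have l : linear (fun u : hom C X Y => f \oc u) by move=> a u v; rewrite compDr compZr.
exists (mklin l) => u v /(congr1 (fun w => g \oc w)).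
by rewrite /= /linear_of_fun !compA gf !comp1m.
Qed.

End Embeddings.

Lemma hom_emb_trans ob ob' ob'' (C : lincat k ob) (C' : lincat k ob') (C'' : lincat k ob'')
  X Y X' Y' X'' Y'' :
  hom_emb C X Y C' X' Y' -> hom_emb C' X' Y' C'' X'' Y'' ->
  hom_emb C X Y C'' X'' Y''.
Proof.
move=> [f fi] [g gi].
by exists (g \o f : {linear _ -> _}); apply: inj_comp.
Qed.

Lemma hom_emb_fd ob ob' (C : lincat k ob) (C' : lincat k ob') X Y X' Y' :
  hom_emb C X Y C' X' Y' -> fd (hom C' X' Y') -> fd (hom C X Y).
Proof. by move=> [f fi]; apply: fd_inj fi. Qed.

Lemma hom_emb_eq0 ob ob' (C : lincat k ob) (C' : lincat k ob') X Y X' Y' :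
  hom_emb C X Y C' X' Y' -> (forall f : hom C' X' Y', f = 0) ->
  forall f : hom C X Y, f = 0.
Proof. by move=> [g gi] h f; apply: gi; rewrite (h (g f)) (h (g 0)). Qed.

Section Functors.
Variables (ob ob' : Type) (C : lincat k ob) (C' : lincat k ob').

Definition faithful F (S : linfunctor C C' F) :=
  forall X Y (f : hom C X Y), S _ _ f = 0 -> f = 0.

Lemma faithful_emb F (S : linfunctor C C' F) X Y :
  faithful S -> hom_emb C X Y C' (F X) (F Y).
Proof. by move=> Sf; exists (S X Y); apply: linearN_inj => f; apply: Sf. Qed.

Lemma functor_isom F (S : linfunctor C C' F) X Y : isom C X Y -> isom C' (F X) (F Y).
Proof.
move=> [f [g /= [gf fg]]]; exists (S _ _ f), (S _ _ g) => /=.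
by rewrite -!fmap_comp gf fg !fmap1.
Qed.

Lemma isomorphic_isom F G (S : linfunctor C C' F) (T : linfunctor C C' G) X :
  isomorphic_functors S T -> isom C' (F X) (G X).
Proof. by move=> [eta [_ h]]; exists (eta X). Qed.

Lemma isomorphic_faithful F G (S : linfunctor C C' F) (T : linfunctor C C' G) :
  isomorphic_functors S T -> faithful T -> faithful S.
Proof.
move=> [eta [nat h]] Tf X Y f Sf0; apply: Tf.
have [t /= [_ e]] := h X.
by rewrite -[T _ _ f]compm1 -e compA nat Sf0 comp0r comp0l.
Qed.

Lemma isomorphic_faithful_sym F G (S : linfunctor C C' F) (T : linfunctor C C' G) :
  isomorphic_functors S T -> faithful S -> faithful T.
Proof.
move=> [eta [nat h]] Sf X Y f Tf0; apply: Sf.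
have [t /= [e _]] := h Y.
by rewrite -[S _ _ f]comp1m -e -compA -nat Tf0 comp0l comp0r.
Qed.

End Functors.

Lemma faithful_id ob (C : lincat k ob) : faithful (linfunctor_id C).
Proof. by []. Qed.

Lemma faithful_of_comp ob ob' ob''
    (C : lincat k ob) (C' : lincat k ob') (C'' : lincat k ob'')
    F G (S : linfunctor C' C'' G) (T : linfunctor C C' F) :
  faithful (linfunctor_comp S T) -> faithful T.
Proof. by move=> h X Y f Tf; apply: h; rewrite /= Tf linear0. Qed.

End LinearCategory.

Section ClusterCategory.
Variables (k : fieldType) (Q : quiver) (H : algType k).
Variable b : vertex Q * seq (arrow Q) -> H.
Hypothesis bP : is_path_algebra b.
Variable L : seq (vertex Q * seq (arrow Q)).
Hypothesis LP : forall p, is_path p -> p \in L.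
Variable D : cluster_data H.

Local Notation DD := (cderived D).
Local Notation isom := (isom DD).
Local Notation emb X Y X' Y' := (hom_emb DD X Y DD X' Y').
Local Notation Fp i X := (zob (cpowers D) i X).

(** By bijectivity of the duality, all functionals on [Hom(Y, tau X)] vanish, and functionals
    separate vectors. *)
Lemma AR_eq0 X Y : (forall f : hom DD X (shift Y), f = 0) ->
  forall g : hom DD Y (tau0 D X), g = 0.
Proof.
move=> h g; have [ar [arb _ _ _]] := tauP D.
apply: separating_functional => phi.
have [ar' _ arK] := arb X Y.
by rewrite -(arK phi) (h (ar' phi)) -(h (ar' \0)) arK.
Qed.

Lemma tau_faithful : faithful (tau D).
Proof.
have [h _] := tauVP D; apply: (@faithful_of_comp _ _ _ _ _ _ _ _ _ (tauV D)).
exact: isomorphic_faithful h (@faithful_id _ _ _).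
Qed.

Lemma tau_tauV_isom X : isom (tau0 D (tauV0 D X)) X.
Proof. by have [_ h] := tauVP D; apply: isomorphic_isom X h. Qed.

Lemma emb_tauV X Y : emb (tauV0 D X) Y X (tau0 D Y).
Proof.
apply: hom_emb_trans (faithful_emb _ _ tau_faithful) _.
exact/hom_emb_isol/tau_tauV_isom.
Qed.

Lemma emb_to_tauV X Y : emb X (tauV0 D Y) (tau0 D X) Y.
Proof.
apply: hom_emb_trans (faithful_emb _ _ tau_faithful) _.
exact/hom_emb_isor/tau_tauV_isom.
Qed.

Lemma Fp0 X : isom (Fp 0 X) X.
Proof.
by apply: isom_sym; exists (zone (cpowers D) erefl X); apply: (zone_iso _ erefl).2.
Qed.

Lemma FpD i j n X : i + j = n -> isom (Fp i (Fp j X)) (Fp n X).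
Proof. by move=> e; exists (zmul (cpowers D) e X); apply: (zmul_iso _ e).2. Qed.

Lemma Fp1 X : isom (Fp 1 X) (tauV0 D (shift X)).
Proof. exact: isomorphic_isom X (cpowersP D). Qed.

Lemma Fp_succ i X : isom (Fp i X) (tauV0 D (shift (Fp (i - 1) X))).
Proof.
apply: isom_trans (Fp1 _); apply: isom_sym; apply: FpD.
by rewrite addrC subrK.
Qed.

(** The composite of the powers [-i] and [i] is isomorphic to the power 0, hence to the identity. *)
Lemma Fp_faithful i : faithful (zfun (cpowers D) i).
Proof.
apply: (@faithful_of_comp _ _ _ _ _ _ _ _ _ (zfun (cpowers D) (- i))).
have h0 : faithful (zfun (cpowers D) 0).
  apply: isomorphic_faithful_sym (@faithful_id _ _ _).
  by exists (zone (cpowers D) erefl); apply: zone_iso.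
apply: isomorphic_faithful h0.
by exists (zmul (cpowers D) (addNr i)); apply: zmul_iso.
Qed.

Definition essentially_le (a : int) (Z : cplx H) := exists2 Z', strict_le Z' a & isom Z' Z.

Lemma essentially_le_isom a Z Z' : isom Z Z' -> essentially_le a Z -> essentially_le a Z'.
Proof. by move=> h [Z0 h0 i0]; exists Z0 => //; apply: isom_trans i0 h. Qed.

Lemma essentially_le_tauV a Z : essentially_le a Z ->
  essentially_le (a - 1) (tauV0 D (shift Z)).
Proof.
move=> [Z' Z'a /(functor_isom (dshift DD))/(functor_isom (tauV D)) h].
apply: essentially_le_isom h _.
have [|Y Ya [s sq]] := @truncation _ _ _ _ bP _ LP (tauV0 D (shift Z')) a DD.
  (* [Hom(tau^-1 Z'[1], W)] embeds in [Hom(Z'[1], tau W)], dual to [Hom(W, Z'[2])]; the resolution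
     of [Z'[2]] lives in degrees at most [a - 1], below those of [W]. *)
  move=> W Wa; apply: (hom_emb_eq0 (emb_tauV _ _)); apply: AR_eq0.
  apply: (@hom_shift_eq0 _ _ _ _ bP _ LP DD W (shift Z') (a - 1) a Wa) => //; last by lia.
  exact: coresolution_strict_le1.
by exists Y => //; exists (dloc DD s); apply: (dloc_iso DD sq).
Qed.

Lemma essentially_le_Fp a T (n : nat) :
  strict_le T a -> essentially_le (a - n%:Z) (Fp n%:Z T).
Proof.
move=> Ta; elim: n => [|n IH].
  by exists T; [rewrite subr0|exact/isom_sym/Fp0].
apply: essentially_le_isom (isom_sym (Fp_succ _ _)) _.
have -> : (n.+1%:Z - 1 = n)%R by lia.
have -> : a - n.+1%:Z = a - n%:Z - 1 by lia.
exact: essentially_le_tauV.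
Qed.

Lemma hom_shift_Fp_eq0 X T : exists M : nat, forall n : nat, (M <= n)%N ->
  forall f : hom DD X (shift (Fp n%:Z T)), f = 0.
Proof.
have [N [TN _]] := cplx_strict T; have [N' [_ XN']] := cplx_strict X.
(* This bound gives [N - n < - N'], so the power lies strictly below [X]. *)
exists (N + N').+1 => n hn.
have [Z Za h] := essentially_le_Fp n TN.
apply: (hom_emb_eq0 (hom_emb_isor _ (functor_isom (dshift DD) (isom_sym h)))).
by apply: (hom_shift_eq0 XN' (@coresolution_strict_le _ _ _ _ bP _ LP _ _ Za)); lia.
Qed.

Lemma emb_Fp X Y i : emb X (Fp i Y) (tau0 D X) (shift (Fp (i - 1) Y)).
Proof.
apply: hom_emb_trans (hom_emb_isor _ (Fp_succ _ _)) _; exact: emb_to_tauV.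
Qed.

Lemma fd_hom_Fp X Y i : fd (hom DD X (Fp i Y)).
Proof. by apply: (hom_emb_fd (emb_Fp _ _ _)); exact: (fd_hom_shift bP LP). Qed.

Lemma hom_Fp_eq0 T : exists M : nat, forall i : int, (M < `|i|)%N ->
  forall f : hom DD T (Fp i T), f = 0.
Proof.
have [M hM] := hom_shift_Fp_eq0 (tau0 D T) T.
have [M' hM'] := hom_shift_Fp_eq0 (tauV0 D T) T.
(* The extra 1 pays for passing from [i] to [i - 1] when [i] is positive. *)
exists (M + M').+1 => i hi; have [i0|i0] := boolP (0 <= i)%R.
  apply: (hom_emb_eq0 (emb_Fp _ _ _)).
  have -> : i - 1 = (absz (i - 1))%:Z by lia.
  by apply: hM; lia.
have [n ni] : exists n : nat, i = - n%:Z by exists (absz i); lia.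
(* For negative [i] the power [n = -i] is applied to both sides, and [T] is written as
   [tau tau^-1 T] to bring in the duality. *)
have e : emb T (Fp i T) (Fp n%:Z T) (tau0 D (tauV0 D T)).
  apply: hom_emb_trans (faithful_emb _ _ (@Fp_faithful n%:Z)) _.
  apply: hom_emb_isor; apply: isom_trans (isom_sym (tau_tauV_isom T)).
  by apply: isom_trans (Fp0 T); apply: FpD; rewrite ni subrr.
apply: (hom_emb_eq0 e); apply: AR_eq0; apply: hM'; lia.
Qed.

(** Only the coefficients of degree between [-M] and [M] can be nonzero, and each lies in a
    finite-dimensional space. *)
Lemma fd_cluster_hom T : fd (hom (cluster_category D) T T).
Proof.
have [M hM] := hom_Fp_eq0 T.
have coef_lin i : linear (fun f : orbit_hom (cpowers D) T T => f i).
  by move=> a f g; rewrite ocoefD ocoefZ.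
pose R : seq int := [seq Posz j - Posz M | j <- iota 0 (M + M).+1].
apply: (@fd_joint _ _ R (hom (cluster_category D) T T)
  (fun i => hom DD T (Fp i T)) (fun i => mklin (coef_lin i))).
  by move=> i _; apply: fd_hom_Fp.
move=> f f0; apply: orbit_hom_eq => i.
have [iM|Mi] := leqP `|i|%N M; last by rewrite (hM i Mi (f i)).
apply: f0; apply/mapP; exists (absz (i + Posz M)); rewrite ?mem_iota; lia.
Qed.

Lemma fd_End_algebra T (A : algType k) : is_End_algebra D T A -> fd A.
Proof. by move=> [phi [phib _ _]]; apply: fd_inj (bij_inj phib) (fd_cluster_hom T). Qed.

End ClusterCategory.

Theorem theoremB (k : closedFieldType) (A : algType k)
    (hA : cluster_tilted_type_D A) : finite_Frobenius_dimension A.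
Proof.
have [n [Q [QD [H [b [bP [D [T [_ TA]]]]]]]]] := hA.
have [L LP] := Dynkin_D_paths QD.
exact: fd_finite_Frobenius_dimension (fd_End_algebra bP LP TA).
Qed.
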